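(* Let $k\geq 3$ be an integer and let $n$ be an integer with $n> \frac{5}{2}k^3+\frac{15}{2}k^2+26k-3$. Then $$ar_3(n,\mathcal{F}_{k+1})=f(n,k)+2.$$
   Context: A 3-graph is a hypergraph all of whose edges have exactly 3 vertices; $K_n^3$ denotes the complete 3-graph on $n$ vertices. For a positive integer $k$, the $k$-star $\mathcal{F}_k$ is the 3-graph consisting of $k$ edges that all contain a common vertex (the core) and pairwise share no other vertex, i.e. any two of the edges intersect exactly in the core. $f(n,k)$ denotes the maximum number of edges in a 3-graph on $n$ vertices containing no copy of $\mathcal{F}_k$ (the Turán number of the $k$-star). An edge-colored hypergraph is rainbow if all its edges have distinct colors; an exactly $t$-edge-coloring is an edge-coloring using all $t$ colors. The anti-Ramsey number $ar_3(n,\mathcal{G})$ of a 3-graph $\mathcal{G}$ is the minimum number $t$ such that every exactly $t$-edge-coloring of $K_n^3$ contains a rainbow copy of $\mathcal{G}$. *)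

(* Defs.v *)
From mathcomp Require Import all_boot.

Set Implicit Arguments.
Unset Strict Implicit.
Unset Printing Implicit Defensive.

(* A 3-graph with vertex type V is a set H : {set {set V}} of edges with
   H \subset complete3 V; complete3 'I_n is the complete 3-graph K_n^3. *)
Definition complete3 (V : finType) : {set {set V}} :=
  [set e : {set V} | #|e| == 3].

(* Image of the edge set G under a vertex map; for injective f these are the
   copies of G (as sub-hypergraphs) on vertex type V. *)
Definition hcopy (U V : finType) (f : U -> V) (G : {set {set U}}) :
  {set {set V}} := [set f @: (e : {set U}) | e in G].

Definition contains_copy (U V : finType) (H : {set {set V}})
    (G : {set {set U}}) : bool :=
  [exists f : {ffun U -> V}, injectiveb f && (hcopy f G \subset H)].

Definition star_edge (k : nat) (i : 'I_k) : {set option ('I_k * bool)} :=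
  [set None; Some (i, false); Some (i, true)].

(* The k-star: the core is None, and the i-th edge has the two further
   vertices Some (i, false) and Some (i, true). *)
Definition star (k : nat) : {set {set option ('I_k * bool)}} :=
  [set star_edge i | i : 'I_k].

Lemma star_sub_complete3 k : star k \subset complete3 _.
Proof.
apply/subsetP => e /imsetP[i _ ->]; rewrite inE /star_edge.
by rewrite setUC cardsU1 cards2 !inE /= (inj_eq Some_inj) xpair_eqE eqxx.
Qed.

Lemma star_edge_inj k : injective (@star_edge k).
Proof.
move=> i j /setP /(_ (Some (i, false))); rewrite !inE /= eqxx.
by rewrite !(inj_eq Some_inj) !xpair_eqE /= andbF orbF andbT => /esym /eqP.
Qed.

Lemma card_star k : #|star k| = k.
Proof. by rewrite card_imset ?card_ord //; apply: star_edge_inj. Qed.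

Lemma star_edgeI k (i j : 'I_k) :
  i != j -> star_edge i :&: star_edge j = [set None].
Proof.
move=> nij; apply/setP => -[[a b]|]; rewrite !inE //=.
rewrite !(inj_eq Some_inj) !xpair_eqE.
by have [->|_] := eqVneq a i; rewrite ?(negPf nij) ?andbF.
Qed.

Definition turan3 (n : nat) (U : finType) (G : {set {set U}}) : nat :=
  \max_(H : {set {set 'I_n}} |
        (H \subset complete3 'I_n) && ~~ contains_copy H G) #|H|.

Definition star_turan (n k : nat) : nat := turan3 n (star k).

(* An edge-coloring of K_n^3 is given by a map c on all vertex sets, of which
   only the values on complete3 'I_n are ever used. *)
Definition exact_coloring (n t : nat) (c : {ffun {set 'I_n} -> 'I_t}) : bool :=
  c @: complete3 'I_n == [set: 'I_t].

Definition rainbow (V T : finType) (c : {set V} -> T) (H : {set {set V}}) :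
  bool :=
  [forall e1 in H, forall e2 in H, (c e1 == c e2) ==> (e1 == e2)].

Definition has_rainbow_copy (n t : nat) (c : {ffun {set 'I_n} -> 'I_t})
    (U : finType) (G : {set {set U}}) : bool :=
  [exists f : {ffun U -> 'I_n},
     [&& injectiveb f, hcopy f G \subset complete3 'I_n
       & rainbow c (hcopy f G)]].

(* The number of colors t is required to be positive: for t = 0 there is no
   exactly t-edge-coloring as soon as n >= 3, so the condition would be
   vacuous and the minimum always 0. *)
Definition ar_forces (n : nat) (U : finType) (G : {set {set U}}) (t : nat) :
  bool :=
  (0 < t) && [forall c : {ffun {set 'I_n} -> 'I_t},
                exact_coloring c ==> has_rainbow_copy c G].

Lemma ar_forces_exists (n : nat) (U : finType) (G : {set {set U}}) :
  exists t, ar_forces n G t.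
Proof.
exists #|complete3 'I_n|.+1; apply/andP; split=> //.
apply/forallP => c; apply/implyP => /eqP Ec.
have := leq_imset_card c (mem (complete3 'I_n)).
by rewrite Ec cardsT card_ord ltnn.
Qed.

Definition ar3 (n : nat) (U : finType) (G : {set {set U}}) : nat :=
  ex_minn (ar_forces_exists n G).

(* Main.v *)
Require Import Defs.
From mathcomp Require Import all_boot all_order all_algebra zify lra.

(* Let d = k - 1 and let c be a coloring without a rainbow (k+1)-star that uses
   f(n,k) + 2 colors; G picks one edge of each color. A color is robust at x if no 2k
   vertices block it in the link of x; a rainbow k-star with core x then uses every
   robust color of x. If some color c0 were robust at every vertex, G minus its edge
   of color c0 would contain no k-star, contradicting |G| = f(n,k) + 2.

   Otherwise, most vertices share a single robust color c0, some vertex x is bad for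
   c0, and |G| is shown to be too small. A pair is heavy if at least 2k edges of G
   contain it. Heavy pairs form a graph of maximum degree at most d, and in the link
   of a vertex u they have matching number at most d, up to the edge of a robust
   color; so u is opposite to at most CH heavy pairs, where CH is the Chvatal-Hanson
   number. Distributing the weight of the edges of G suitably, also those without
   heavy pairs, every vertex receives at most about CH. The bad vertex x forces the
   typical vertex to receive at most CH - 1: the link of u minus x has matching number
   at most d - 1, and in the one case where this alone does not suffice (d odd, x of
   heavy degree d) the Gallai-Edmonds decomposition provides a further vertex of heavy
   degree d which is missed by a maximum matching and transports the robust color of x
   to u. On the other hand f(n,k) >= CH (n - 2k), by joining the edges of an extremal
   Chvatal-Hanson graph to all remaining vertices. *)

(** A vertex may lie on up to 2k - 1 edges of a link through light pairs, so the Chvatal-Hanson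
    bound does not apply to the link directly. The weights restore it: edges without heavy pairs are
    divided so that all weighted degrees are at most 12d in the link of a vertex of small heavy
    degree, while a vertex of larger heavy degree pays for its link by losing one matching edge per
    heavy neighbour. Twelfths make the shares 1, 1/2, 1/3 and 1/4 integral.

    The threshold 2k for heaviness is what greedy extension needs: a new star edge through a heavy
    pair must avoid fewer than 2k vertices and colors in total. The matching bounds hold only after
    edges of robust colors are dropped from G, and the dropped edges must be paid for by slack
    elsewhere.

    The construction falls short of CH n by about 2k CH, which is about 2k^3; this is made up by the
    one edge saved at each typical vertex, whence a bound on n that is cubic in k. *)

Set Implicit Arguments.
Unset Strict Implicit.
Unset Printing Implicit Defensive.

(** * Matchings *)

(* lia compares its atoms up to conversion, which diverges in practice on
   cardinals and maxima: they are first replaced by variables. *)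
Ltac gen_card :=
  repeat match goal with
  | H : is_true (leq _ _) |- _ => revert H
  | H : is_true (~~ leq _ _) |- _ => revert H
  | H : @eq nat _ _ |- _ => revert H
  | H : is_true (@eq_op nat _ _) |- _ => revert H
  | H : _ \/ _ |- _ => revert H
  end;
  unfold reverse_coercion;
  repeat match goal with |- context [card ?A] => generalize (card A) end.
Ltac card_lia := gen_card; clear; intros; lia.

(* Specializations to {set T}: the general lemmas yield cardinals that are only
   convertible, not syntactically equal, to those of sets. *)
Lemma leq_cards (T : finType) (A B : {set T}) : A \subset B -> #|A| <= #|B|.
Proof. exact: subset_leq_card. Qed.

Lemma ltn_cards (T : finType) (A B : {set T}) : A \proper B -> #|A| < #|B|.
Proof. exact: proper_card. Qed.

Section Matching.
Variables (V : finType) (E : {set {set V}}).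
Hypothesis E2 : forall e, e \in E -> #|e| = 2.
Implicit Types (M N : {set {set V}}) (U C D : {set V}) (a u v w : V).

Definition matching M U := [&& M \subset E, trivIset M & cover M \subset U].

Definition nu U := \max_(M : {set {set V}} | matching M U) #|M|.

Ltac nu_lia :=
  gen_card; repeat match goal with |- context [nu ?U] => generalize (nu U) end;
  clear; intros; lia.

Lemma matching0 U : matching set0 U.
Proof.
rewrite /matching sub0set /trivIset /cover !big_set0 cards0 eqxx.
exact: sub0set.
Qed.

Lemma nu_le M U : matching M U -> #|M| <= nu U.
Proof. by move=> mM; apply: leq_bigmax_cond. Qed.

Lemma nu_ex U : exists2 M, matching M U & #|M| = nu U.
Proof.
have [|M mM eM] := @eq_bigmax_cond _ [pred M | matching M U] (fun M => #|M|).
  by apply/card_gt0P; exists set0; apply: matching0.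
by exists M.
Qed.

Lemma matching_sub M U D : U \subset D -> matching M U -> matching M D.
Proof. by move=> sUD /and3P[sM tM cM]; rewrite /matching sM tM (subset_trans cM). Qed.

Lemma nu_sub U D : U \subset D -> nu U <= nu D.
Proof.
by move=> sUD; have [M mM <-] := nu_ex U; apply/nu_le/(matching_sub sUD).
Qed.

Lemma matching_subset M N U : N \subset M -> matching M U -> matching N U.
Proof.
move=> sNM /and3P[sM tM cM]; apply/and3P; split.
- exact: subset_trans sM.
- exact: trivIsetS sNM tM.
- apply: subset_trans cM; apply/subsetP => x /bigcupP[e eN xe].
  by apply/bigcupP; exists e => //; apply: (subsetP sNM).
Qed.

Lemma matching_disj M U e f x :
  matching M U -> e \in M -> f \in M -> x \in e -> x \in f -> e = f.
Proof.
move=> /and3P[_ /trivIsetP tM _] eM fM xe xf; apply/eqP/negPn/negP => nef.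
have /pred0P/(_ x) := tM e f eM fM nef.
by rewrite /= xe xf.
Qed.

Lemma card_cover_matching M U : matching M U -> #|cover M| = 2 * #|M|.
Proof.
move=> /and3P[sM /eqP <- _]; rewrite (eq_bigr (fun=> 2)) ?sum_nat_const 1?mulnC //.
by move=> e /(subsetP sM)/E2.
Qed.

Lemma nu_D1 U a : nu U <= (nu (U :\ a)).+1.
Proof.
have [M mM <-] := nu_ex U; have [aM|aM] := boolP (a \in cover M).
  have /bigcupP[e eM ae] := aM; rewrite (cardsD1 e) eM add1n ltnS; apply: nu_le.
  have mD := matching_subset (subD1set M e) mM.
  case/and3P: (mD) => sM tM cM; apply/and3P; split=> //.
  apply/subsetP => x xc; rewrite !inE (subsetP cM) // andbT.
  apply/eqP => xa; case/bigcupP: xc => f; rewrite !inE xa => /andP[nf fM] af.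
  by rewrite (matching_disj mM fM eM af ae) eqxx in nf.
apply/leqW/nu_le; case/and3P: (mM) => sM tM cM; apply/and3P; split=> //.
apply/subsetP => x xc; rewrite !inE (subsetP cM) // andbT.
by apply: contraNneq aM => <-.
Qed.

Lemma matching_add M U u v :
  matching M U -> [set u; v] \in E -> u \in U -> v \in U ->
  u \notin cover M -> v \notin cover M ->
  matching ([set u; v] |: M) U /\ #|[set u; v] |: M| = #|M|.+1.
Proof.
move=> mM uvE uU vU uM vM.
have nM : [set u; v] \notin M.
  by apply: contra uM => iM; apply/bigcupP; exists [set u; v]; rewrite ?inE ?eqxx.
split; last by rewrite cardsU1 nM.
case/and3P: (mM) => sM tM cM; apply/and3P; split.
- by rewrite subUset sub1set uvE.
- have [] // := @trivIsetU1 _ [set u; v] M; last first.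
    by apply: contraTN isT => /(subsetP sM)/E2; rewrite cards0.
  move=> f fM; rewrite disjoints_subset; apply/subsetP => x.
  by rewrite !inE => /orP[] /eqP->; [apply: contra uM|apply: contra vM];
     move=> xf; apply/bigcupP; exists f.
- rewrite /cover bigcup_setU big_set1 subUset cM andbT.
  by apply/subsetP => x; rewrite !inE => /orP[] /eqP->.
Qed.

(** * Switching along alternating components, and the Gallai-Edmonds decomposition *)

Definition inside M C := [set e in M | e \subset C].

Definition closed_for M C := forall e, e \in M -> (e \subset C) || [disjoint e & C].

Lemma closed_inside M U C x :
  matching M U -> closed_for M C -> x \in C -> (x \in cover (inside M C)) = (x \in cover M).
Proof.
move=> mM cC xC; apply/bigcupP/bigcupP => -[e]; rewrite ?inE => eM xe; exists e => //.
  by case/andP: eM.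
rewrite inE eM; case/orP: (cC e eM) => // /pred0P/(_ x).
by rewrite /= xe xC.
Qed.

Lemma card_inside M U C :
  matching M U -> closed_for M C -> 2 * #|inside M C| = #|C :&: cover M|.
Proof.
move=> mM cC; have mI : matching (inside M C) U.
  by apply: matching_subset mM; apply/subsetP => e; rewrite inE => /andP[].
rewrite -(card_cover_matching mI); apply: eq_card => x; rewrite inE.
have [xC|xC] := boolP (x \in C); first by rewrite (closed_inside mM cC).
apply/negbTE/bigcupP => -[e]; rewrite inE => /andP[_ /subsetP sC] /sC.
by rewrite (negPf xC).
Qed.

Lemma card_missed M U C : matching M U -> closed_for M C ->
  #|C :\: cover M| + 2 * #|inside M C| = #|C|.
Proof. by move=> mM cC; rewrite (card_inside mM cC) addnC cardsID. Qed.

(* The component of w in the union of two matchings is a path or a cycle; it is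
   found as a maximal set spanned by at least |C| - 1 edges. *)
Lemma alternating_component M N U U' w : matching M U -> matching N U' ->
  exists C, [/\ w \in C, closed_for M C, closed_for N C &
    #|C :\: cover M| + #|C :\: cover N| <= 2].
Proof.
move=> mM mN; pose Q C := (w \in C) && (#|C| <= #|inside M C| + #|inside N C| + 1).
have Q1 : Q [set w] by rewrite /Q inE eqxx cards1 addn1.
have [C /andP[wC cC] maxC] :
    exists2 C : {set V}, Q C & forall D : {set V}, Q D -> #|D| <= #|C|.
  by have [C QC maxC] := @arg_maxnP _ [set w] Q (fun C => #|C|) Q1; exists C.
(* An edge that meets [C] and leaves it at y could be absorbed: y adds one vertex and at least one
   edge, against the maximality of [C]. *)
have grow e : e \in M :|: N -> (e \subset C) || [disjoint e & C].
  move=> eMN; apply/norP => -[/subsetPn[y ye yC] /pred0Pn[z /andP[/= ze zC]]].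
  have eE : #|e| = 2.
    apply: E2; case/setUP: eMN => /(subsetP _); apply.
    by case/and3P: mM. by case/and3P: mN.
  have ezy : e \subset y |: C.
    apply/subsetP => x xe; rewrite !inE; have [//|nxy /=] := eqVneq x y.
    have [->//|nxz] := eqVneq x z.
    have: #|[set x; y; z]| <= #|e|.
      by apply/leq_cards/subsetP => t; rewrite !inE => /orP[/orP[]|] /eqP->.
    rewrite eE setUC cardsU1 cards2 nxy !inE negb_or ![z == _]eq_sym nxz.
    by have [yz|_] := eqVneq y z; [rewrite yz zC in yC | ].
  have sub (K : {set {set V}}) : inside K C \subset inside K (y |: C).
    apply/subsetP => f; rewrite !inE => /andP[-> /= fC].
    by apply: subset_trans fC _; apply: subsetUr.
  have neC : ~~ (e \subset C) by apply/subsetPn; exists y.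
  have str (K : {set {set V}}) : e \in K -> #|inside K C| < #|inside K (y |: C)|.
    move=> eK; apply: ltn_cards; rewrite properE sub /=.
    by apply/subsetPn; exists e; rewrite !inE eK //= ?ezy // (negPf neC).
  have QyC : Q (y |: C).
    rewrite /Q inE wC orbT andTb cardsU1 yC add1n.
    have := leq_cards (sub M); have := leq_cards (sub N).
    by case/setUP: eMN => /str; nu_lia.
  by have := maxC _ QyC; rewrite cardsU1 yC; nu_lia.
have cM : closed_for M C by move=> e eM; apply: grow; rewrite inE eM.
have cN : closed_for N C by move=> e eN; apply: grow; rewrite inE eN orbT.
exists C; split=> //.
have := card_missed mM cM; have := card_missed mN cN; nu_lia.
Qed.

Definition switch M N C := (M :\: inside M C) :|: inside N C.

Lemma cover_switch M N U U' C x : matching M U -> matching N U' ->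
  closed_for M C -> closed_for N C ->
  (x \in cover (switch M N C)) = (x \in if x \in C then cover N else cover M).
Proof.
move=> mM mN cM cN; have [xC|xC] := boolP (x \in C); last first.
  apply/bigcupP/bigcupP => -[e].
    rewrite !inE => /orP[/andP[_ eM] xe|/andP[_ /subsetP sC] /sC]; first by exists e.
    by rewrite (negPf xC).
  move=> eM xe; exists e => //; rewrite !inE eM /= andbT.
  by apply/orP; left; apply: contra xC => /subsetP; apply.
rewrite -(closed_inside mN cN xC); apply/bigcupP/bigcupP => -[e].
  rewrite !inE => /orP[/andP[h eM] xe|eN xe]; last by exists e; rewrite ?inE.
  rewrite eM /= in h; have := cM e eM; rewrite (negPf h) => /pred0P/(_ x).
  by rewrite /= xe xC.
by rewrite inE => eN xe; exists e => //; rewrite !inE eN orbT.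
Qed.

Lemma switch_matching M N U U' C D : matching M U -> matching N U' ->
  closed_for M C -> closed_for N C -> cover (switch M N C) \subset D ->
  matching (switch M N C) D.
Proof.
move=> mM mN cM cN sD; case/and3P: (mM) => sM tM _; case/and3P: (mN) => sN tN _.
apply/and3P; split=> //.
  rewrite subUset; apply/andP; split; first exact: subset_trans (subsetDl _ _) sM.
  by apply: subset_trans sN; apply/subsetP => e; rewrite inE => /andP[].
have key (e f : {set V}) : e \in M -> ~~ (e \subset C) -> f \subset C -> [disjoint e & f].
  move=> eM neC fC; have := cM e eM; rewrite (negPf neC) /= => dC.
  exact: disjointWr fC dC.
apply/trivIsetP => e f; rewrite !inE.
case/orP=> /andP[h1 h2]; case/orP=> /andP[h3 h4] nef.
- by move/trivIsetP: tM; apply.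
- by rewrite h2 /= in h1; apply: key.
- by rewrite h4 /= in h3; rewrite disjoint_sym; apply: key.
- by move/trivIsetP: tN; apply.
Qed.

Lemma card_switch M N U U' C : matching M U -> matching N U' ->
  closed_for M C -> closed_for N C ->
  #|switch M N C| + #|inside M C| = #|M| + #|inside N C|.
Proof.
move=> mM mN cM cN; rewrite cardsU.
have -> : (M :\: inside M C) :&: inside N C = set0.
  apply/setP => e; rewrite !inE; apply/negP => /andP[/andP[h eM] /andP[_ eC]].
  by rewrite eM eC in h.
have sI : inside M C \subset M by apply/subsetP => e; rewrite inE => /andP[].
rewrite cards0 subn0 cardsD (setIidPr sI).
by have := leq_cards sI; nu_lia.
Qed.

(** If w were essential in [U], compare a maximum matching [M] missing v with a maximum matching [N]
    of U - {a, w}, which has one edge less. When a is outside the component of w, one of the two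
    switches gives a matching with too many edges missing w or a. *)
Lemma gallai_stability U a v w : a \in U -> v \in U -> [set a; v] \in E ->
  nu (U :\ a) < nu U -> nu (U :\ v) = nu U -> w \in U -> w != a ->
  nu (U :\ a :\ w) = nu (U :\ a) -> nu (U :\ w) = nu U.
Proof.
move=> aU vU avE ess_a iness_v wU nwa iness_w.
apply/eqP; rewrite eqn_leq nu_sub ?subD1set //= leqNgt; apply/negP => ess_w.
have nav : a != v by apply: contraTneq ess_a => ->; rewrite iness_v ltnn.
have nwv : w != v by apply: contraTneq ess_w => ->; rewrite iness_v ltnn.
have [M mM cM] := nu_ex (U :\ v); have [N mN cN] := nu_ex (U :\ a :\ w).
have /and3P[_ _ covM] := mM; have /and3P[_ _ covN] := mN.
have vM : v \notin cover M by apply: contraTN isT => /(subsetP covM); rewrite !inE eqxx.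
have aN : a \notin cover N.
  by apply: contraTN isT => /(subsetP covN); rewrite !inE eqxx andbF.
have wN : w \notin cover N by apply: contraTN isT => /(subsetP covN); rewrite !inE eqxx.
have [C [wC clM clN missC]] := alternating_component w mM mN.
have cvMN := cover_switch _ mM mN clM clN.
have cvNM := cover_switch _ mN mM clN clM.
have kMN := card_switch mM mN clM clN; have kNM := card_switch mN mM clN clM.
have kM := card_missed mM clM; have kN := card_missed mN clN.
have nuD := nu_D1 U a.
have inU x : x \in cover M -> x \in U by move/(subsetP covM); rewrite inE => /andP[].
have inU' x : x \in cover N -> x \in U.
  by move/(subsetP covN); rewrite !inE => /andP[_ /andP[]].
have sw_w : matching (switch M N C) (U :\ w).
  apply: (switch_matching mM mN clM clN); apply/subsetP => x; rewrite cvMN !inE.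
  have [->|nxw /=] := eqVneq x w; first by rewrite wC (negPf wN).
  by case: ifP => _; [apply: inU'|apply: inU].
have [aC|aC] := boolP (a \in C); last first.
  have [le|lt] := leqP #|inside M C| #|inside N C|; first by have := nu_le sw_w; nu_lia.
  have sw_a : matching (switch N M C) (U :\ a).
    apply: (switch_matching mN mM clN clM); apply/subsetP => x; rewrite cvNM !inE.
    have [->|nxa /=] := eqVneq x a; first by rewrite (negPf aC) (negPf aN).
    by case: ifP => _; [apply: inU|apply: inU'].
  by have := nu_le sw_a; nu_lia.
(* [N] misses a and w in [C], so [M] misses nothing there and v is outside [C]. Replacing [M] by [N]
   on [C] costs one edge, which the edge av restores while w stays missed. *)
have two : 2 <= #|C :\: cover N|.
  rewrite -(_ : #|[set a; w]| = 2); last by rewrite cards2 eq_sym nwa.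
  by apply/leq_cards/subsetP => x; rewrite !inE => /orP[] /eqP->;
     rewrite ?aN ?wN ?aC ?wC.
have vC : v \notin C.
  apply/negP => vC; have: 0 < #|C :\: cover M|.
    by apply/card_gt0P; exists v; rewrite !inE vM.
  nu_lia.
have [||||mA cA] := matching_add sw_w avE; rewrite ?inE ?aU ?vU ?andbT 1?eq_sym //.
- by rewrite cvMN aC.
- by rewrite cvMN (negPf vC).
by have := nu_le mA; nu_lia.
Qed.

(** Distinct vertices are related when no maximum matching of [D] misses both. *)
Definition gallai_eq D u v := (u == v) || (nu (D :\ u :\ v) < nu D).

(** The core of Gallai's lemma. Let [M] be a maximum matching missing u and v, and [N] one missing
    t. By maximality both miss equally many vertices in the component of t, hence at most one each.
    So u or v is outside, and switching on the component gives a maximum matching missing that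
    vertex and t. *)
Lemma gallai_trans D u t v : (forall x, x \in D -> nu (D :\ x) = nu D) ->
  u \in D -> t \in D -> v \in D ->
  gallai_eq D u t -> gallai_eq D t v -> gallai_eq D u v.
Proof.
move=> iness uD tD vD; rewrite /gallai_eq.
have [->|nut /=] := eqVneq u t; first by [].
have [<-|ntv /=] := eqVneq t v; first by move=> ->; rewrite ?orbT.
move=> lut ltv; have [//|nuv /=] := eqVneq u v.
rewrite ltnNge; apply/negP => geuv.
have [M mM cM] := nu_ex (D :\ u :\ v); have [N mN cN] := nu_ex (D :\ t).
rewrite iness // in cN.
have cM' : #|M| = nu D.
  by apply/eqP; rewrite cM eqn_leq geuv andbT nu_sub // setDDl subsetDl.
have /and3P[_ _ covM] := mM; have /and3P[_ _ covN] := mN.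
have uM : u \notin cover M.
  by apply: contraTN isT => /(subsetP covM); rewrite !inE eqxx andbF.
have vM : v \notin cover M by apply: contraTN isT => /(subsetP covM); rewrite !inE eqxx.
have tN : t \notin cover N by apply: contraTN isT => /(subsetP covN); rewrite !inE eqxx.
have [C [tC clM clN missC]] := alternating_component t mM mN.
have cvMN := cover_switch _ mM mN clM clN.
have cvNM := cover_switch _ mN mM clN clM.
have kMN := card_switch mM mN clM clN; have kNM := card_switch mN mM clN clM.
have kM := card_missed mM clM; have kN := card_missed mN clN.
have inD x : x \in cover M -> x \in D.
  by move/(subsetP covM); rewrite !inE => /andP[_ /andP[]].
have inD' x : x \in cover N -> x \in D by move/(subsetP covN); rewrite !inE => /andP[].
have swM : matching (switch M N C) D.
  apply: (switch_matching mM mN clM clN); apply/subsetP => x; rewrite cvMN.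
  by case: ifP => _; [apply: inD'|apply: inD].
have swN : matching (switch N M C) D.
  apply: (switch_matching mN mM clN clM); apply/subsetP => x; rewrite cvNM.
  by case: ifP => _; [apply: inD|apply: inD'].
have := nu_le swM; have := nu_le swN => h1 h2.
have pos : 0 < #|C :\: cover N| by apply/card_gt0P; exists t; rewrite !inE tN.
have missM : #|C :\: cover M| <= 1 by nu_lia.
have bad z : z \in D -> z != t -> z \notin cover M -> z \notin C -> nu D <= nu (D :\ z :\ t).
  move=> zD nzt zM zC; have: matching (switch M N C) (D :\ z :\ t).
    apply: (switch_matching mM mN clM clN); apply/subsetP => x; rewrite cvMN !inE.
    have [->|_] := eqVneq x t; first by rewrite tC (negPf tN).
    have [->|_ /=] := eqVneq x z; first by rewrite (negPf zC) (negPf zM).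
    by case: ifP => _; [apply: inD'|apply: inD].
  by move/nu_le; nu_lia.
have [uC|uC] := boolP (u \in C); last by have := bad u uD nut uM uC; nu_lia.
have [vC|vC] := boolP (v \in C); last first.
  have := bad v vD _ vM vC; rewrite eq_sym ntv => /(_ isT).
  by rewrite setDDl setUC -setDDl; nu_lia.
have: 2 <= #|C :\: cover M|.
  rewrite -(_ : #|[set u; v]| = 2); last by rewrite cards2 nuv.
  by apply/leq_cards/subsetP => x; rewrite !inE => /orP[] /eqP->;
     rewrite ?uM ?vM ?uC ?vC.
nu_lia.
Qed.

Lemma gallai_sym D u v : gallai_eq D u v = gallai_eq D v u.
Proof. by rewrite /gallai_eq eq_sym setDDl setUC -setDDl. Qed.

Lemma edgeP e : e \in E -> exists u v, u != v /\ e = [set u; v].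
Proof. by move/E2/eqP/cards2P => [u [v [nuv ->]]]; exists u, v. Qed.

Lemma gallai_edge D u v : u \in D -> v \in D -> [set u; v] \in E -> gallai_eq D u v.
Proof.
move=> uD vD uvE; rewrite /gallai_eq orbC; apply/orP; left.
have [M mM cM] := nu_ex (D :\ u :\ v); have /and3P[_ _ covM] := mM.
have sD : D :\ u :\ v \subset D by rewrite setDDl subsetDl.
have [] := matching_add (matching_sub sD mM) uvE uD vD.
- by apply: contraTN isT => /(subsetP covM); rewrite !inE eqxx andbF.
- by apply: contraTN isT => /(subsetP covM); rewrite !inE eqxx.
by move=> /nu_le; nu_lia.
Qed.

(** Edges do not leave a class, and a maximum matching misses at most one vertex of each class; so
    it contains, inside each class, half as many edges as there are vertices, rounded down. *)
Lemma gallai_classes D : (forall x, x \in D -> nu (D :\ x) = nu D) ->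
  exists s : seq {set V}, [/\
    forall e, e \in E -> e \subset D -> exists2 K : {set V}, K \in s & e \subset K,
    forall y, y \in D -> exists2 K : {set V}, K \in s & y \in K,
    forall K : {set V}, K \in s -> K \subset D &
    \sum_(K <- s) #|K|./2 <= nu D].
Proof.
move=> iness; pose P := equivalence_partition (gallai_eq D) D.
have eqR : {in D & &, equivalence_rel (gallai_eq D)}.
  move=> x y z xD yD zD; split; first by rewrite /gallai_eq eqxx.
  move=> xy; apply/idP/idP; last exact: (gallai_trans iness xD yD zD).
  by apply: (gallai_trans iness yD xD zD); rewrite gallai_sym.
have /and3P[/eqP covP trivP nP] := equivalence_partitionP eqR.
have blk := pblock_equivalence_partition eqR.
have KD K : K \in P -> K \subset D.
  by move=> KP; rewrite -covP; apply: (bigcup_sup K).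
have samK K x y : K \in P -> x \in K -> y \in D -> (y \in K) = gallai_eq D x y.
  move=> KP xK yD; rewrite -(def_pblock trivP KP xK) blk //.
  exact: (subsetP (KD K KP)).
exists (enum P); split=> [e eE eD|y yD|K|].
- have [u [v [nuv def_e]]] := edgeP eE;
  have uD : u \in D by rewrite (subsetP eD) // def_e !inE eqxx.
  have vD : v \in D by rewrite (subsetP eD) // def_e !inE eqxx orbT.
  exists (pblock P u); first by rewrite mem_enum pblock_mem ?covP.
  rewrite def_e subUset !sub1set mem_pblock covP uD blk //=.
  by apply: gallai_edge; rewrite -?def_e.
- by exists (pblock P y); rewrite ?mem_enum ?pblock_mem ?mem_pblock ?covP.
- by rewrite mem_enum => /KD.
have [M mM cM] := nu_ex D; have /and3P[sM _ covM] := mM.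
have inM K : K \in P -> #|K|./2 <= #|inside M K|.
  move=> KP; have clK : closed_for M K.
    move=> e eM; have [u [v [nuv def_e]]] := edgeP (subsetP sM e eM).
    have eD : e \subset D.
      by apply: subset_trans covM; apply: (bigcup_sup e).
    have uD : u \in D by rewrite (subsetP eD) // def_e !inE eqxx.
    have vD : v \in D by rewrite (subsetP eD) // def_e !inE eqxx orbT.
    have uv : gallai_eq D u v by apply: gallai_edge; rewrite -?def_e ?(subsetP sM).
    have eqK : (u \in K) = (v \in K).
      by apply/idP/idP => h; [rewrite (samK K u)|rewrite (samK K v) // gallai_sym].
    have [uK|uK] := boolP (u \in K); first by rewrite def_e subUset !sub1set -eqK uK.
    apply/orP; right; rewrite disjoints_subset def_e subUset !sub1set !inE -eqK.
    by rewrite uK.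
  have := card_missed mM clK.
  have : #|K :\: cover M| <= 1.
    rewrite leqNgt; apply/card_gt1P => -[u [v [uK vK nuv]]].
    move: uK vK; rewrite !inE => /andP[uM uK] /andP[vM vK].
    have := samK K u v KP uK (subsetP (KD K KP) v vK).
    rewrite vK /gallai_eq (negPf nuv) /= => /esym; apply/negP; rewrite -leqNgt -cM.
    apply: nu_le; case/and3P: (mM) => h1 h2 h3; apply/and3P; split=> //.
    apply/subsetP => x xM; rewrite !inE (subsetP h3 x xM) andbT.
    by apply/andP; split; [apply: contraNneq vM|apply: contraNneq uM] => <-.
  nu_lia.
rewrite big_enum_cond /= -cM.
apply: leq_trans (_ : \sum_(K in P) #|inside M K| <= _).
  by under eq_bigl do rewrite andbT; apply: leq_sum.
have cI K : #|inside M K| = \sum_(e in M) (e \subset K : nat).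
  by rewrite -sum1dep_card big_mkcondr; apply: eq_bigr => e _; case: (e \subset K).
under eq_bigr => K _ do rewrite cI.
rewrite exchange_big /= -sum1_card; apply: leq_sum => e eM.
have [u [v [nuv def_e]]] := edgeP (subsetP sM e eM).
rewrite (eq_bigr (fun K : {set V} => if e \subset K then 1 else 0)); last by move=> K _;
  case: ifP.
rewrite -big_mkcondr /= sum1dep_card.
rewrite -(cards1 (pblock P u)); apply/subset_leq_card/subsetP => K; rewrite !inE.
move=> /andP[KP eK]; apply/eqP; rewrite (def_pblock trivP KP) //.
by apply: (subsetP eK); rewrite def_e !inE eqxx.
Qed.

(* Delete essential vertices adjacent to inessential ones as long as possible: by
   stability the inessential vertices do not change, and they end up separated from
   the essential ones, which are then perfectly matched. *)
Theorem gallai_edmonds U : exists (A : {set V}) (s : seq {set V}), [/\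
    A \subset U,
    forall e, e \in E -> e \subset U :\: A -> exists2 K : {set V}, K \in s & e \subset K,
    forall y, y \in U -> y \in A \/ exists2 K : {set V}, K \in s & y \in K,
    #|A| + \sum_(K <- s) #|K|./2 <= nu U &
    forall K : {set V}, K \in s -> K \subset U :\: A /\
      forall q, odd #|K| -> q \in K -> nu (U :\ q) = nu U].
Proof.
have [m] := ubnP #|U|; elim: m U => // m IHm U ltUm.
pose D := [set v in U | nu (U :\ v) == nu U].
have [/existsP[a /existsP[v /and3P[aC vD avE]]]|noedge] :=
  boolP [exists a, exists v, [&& a \in U :\: D, v \in D & [set a; v] \in E]].
  move: aC vD; rewrite !inE => /andP[h aU] /andP[vU /eqP iv].
  rewrite aU /= in h.
  have ess : nu (U :\ a) < nu U by rewrite ltn_neqAle h nu_sub // subD1set.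
  have [|A [s [sA hE hU hle hodd]]] := IHm (U :\ a).
    by move: ltUm; rewrite (cardsD1 a U) aU; card_lia.
  have aA : a \notin A by apply: contraTN isT => /(subsetP sA); rewrite !inE eqxx.
  exists (a |: A), s; split=> //.
  - rewrite subUset sub1set aU; apply: subset_trans sA _; exact: subD1set.
  - by move=> e eE eU; apply: hE => //; rewrite setDDl.
  - move=> y yU; have [->|nya] := eqVneq y a; first by left; rewrite !inE eqxx.
    by case: (hU y); rewrite ?inE ?nya // => h'; [left; rewrite h' orbT|right].
  - by rewrite cardsU1 aA; nu_lia.
  - move=> K Ks; have [sK oddK] := hodd K Ks; rewrite -setDDl; split=> // q oK qK.
    have := subsetP sK q qK; rewrite !inE => /and3P[_ nqa qU].
    exact: (gallai_stability aU vU avE ess iv qU nqa (oddK q oK qK)).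
pose C := U :\: D; have DU : D \subset U by apply/subsetP => x; rewrite inE => /andP[].
have nocross u v : u \in C -> v \in D -> [set u; v] \in E -> False.
  move=> uC vD uvE; move/existsP: noedge; apply.
  by exists u; apply/existsP; exists v; apply/and3P.
have split_edge e : e \in E -> e \subset U -> (e \subset C) || (e \subset D).
  move=> eE eU; have [u [v [nuv def_e]]] := edgeP eE.
  have uU : u \in U by rewrite (subsetP eU) // def_e !inE eqxx.
  have vU : v \in U by rewrite (subsetP eU) // def_e !inE eqxx orbT.
  have inC x : x \in U -> (x \in C) = (x \notin D) by move=> xU; rewrite in_setD xU andbT.
  rewrite def_e !subUset !sub1set !inC //.
  have [uD|uD] := boolP (u \in D); have [vD|vD] := boolP (v \in D) => //=.
    by case: (nocross v u); rewrite ?inC // setUC -def_e.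
  by case: (nocross u v); rewrite ?inC // -def_e.
have dCD e : e \in E -> e \subset D -> [disjoint e & C].
  move=> eE eD; rewrite disjoints_subset; apply: subset_trans eD _.
  by apply/subsetP => x xD; rewrite in_setC in_setD xD.
have closC N W : matching N W -> W \subset U -> closed_for N C.
  move=> mN WU e eN; case/and3P: (mN) => sN _ cN; have eE := subsetP sN e eN.
  have eU : e \subset U by apply: subset_trans (subset_trans cN WU); apply: (bigcup_sup e).
  by case/orP: (split_edge e eE eU) => [->//|/(dCD e eE)->]; rewrite orbT.
have [M mM cM] := nu_ex U; have clM := closC M U mM (subxx U).
have missM : #|C :\: cover M| = 0.
  apply/eqP; rewrite cards_eq0; apply/eqP/setP => x; rewrite !inE.
  apply/negP => /andP[xM /andP[xD xU]]; move: xD; rewrite xU /=.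
  rewrite eqn_leq nu_sub ?subD1set //= -cM => /negP; apply; apply: nu_le.
  case/and3P: (mM) => h1 h2 h3; apply/and3P; split=> //.
  apply/subsetP => y yM; rewrite !inE (subsetP h3 y yM) andbT.
  by apply: contraNneq xM => <-.
have kM := card_missed mM clM.
have nuD : nu D + #|inside M C| <= nu U.
  have [N mN <-] := nu_ex D.
  have clN := closC N D mN DU.
  have inN0 : inside N C = set0.
    apply/setP => e; rewrite !inE; apply/negP => /andP[eN eC].
    case/and3P: (mN) => sN _ cN; have [u [v [nuv def_e]]] := edgeP (subsetP sN e eN).
    have uD : u \in D.
      by apply: (subsetP cN); apply/bigcupP; exists e; rewrite // def_e !inE eqxx.
    by have := subsetP eC u; rewrite def_e in_set2 eqxx in_setD uD => /(_ isT).
  have := card_switch mN mM clN clM; rewrite inN0 cards0 => <-.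
  rewrite addn0; apply: nu_le; apply: (switch_matching mN mM clN clM).
  apply/subsetP => x; rewrite (cover_switch x mN mM clN clM).
  case: ifP => _; first by case/and3P: (mM) => _ _ /subsetP; apply.
  by case/and3P: (mN) => _ _ /subsetP cN /cN /(subsetP DU).
have inessD x : x \in D -> nu (D :\ x) = nu D.
  move=> xD; apply/eqP; rewrite eqn_leq nu_sub ?subD1set //=.
  move: (xD); rewrite inE => /andP[xU /eqP nux].
  have [N mN cN] := nu_ex (U :\ x); rewrite nux in cN.
  have clN := closC N _ mN (subD1set _ _); have kN := card_missed mN clN.
  have : matching (N :\: inside N C) (D :\ x).
    have := matching_subset (subsetDl N (inside N C)) mN.
    case/and3P=> h1 h2 h3; apply/and3P; split=> //.
    apply/subsetP => y /bigcupP[e]; rewrite !inE => /andP[h eN] ye.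
    have eU : e \subset U :\ x by case/and3P: (mN) => _ _; apply: subset_trans;
      apply: (bigcup_sup e).
    have := subsetP eU y ye; rewrite !inE => /andP[-> yU]; rewrite yU /=.
    have eE : e \in E by case/and3P: (mN) => sN _ _; apply: (subsetP sN).
    case/orP: (split_edge e eE (subset_trans eU (subD1set _ _))) => [eC|/subsetP/(_ y ye)].
      by rewrite eN eC in h.
    by rewrite inE => /andP[].
  move/nu_le; rewrite cardsD.
  have sI : inside N C \subset N by apply/subsetP => e; rewrite inE => /andP[].
  rewrite (setIidPr sI); have := leq_cards sI; nu_lia.
have [s [hE hD hK hle]] := gallai_classes inessD.
(* The essential vertices form one more block. By [missM] they are perfectly matched, so this block
   is even and the condition on odd blocks is void for it. *)
exists set0, (C :: s); split; first exact: sub0set.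
- move=> e eE; rewrite setD0 => eU; case/orP: (split_edge e eE eU) => [eC|eD].
    by exists C; rewrite ?inE ?eqxx.
  by have [K Ks eK] := hE e eE eD; exists K; rewrite ?inE ?Ks ?orbT.
- move=> y yU; right; have [yD|yD] := boolP (y \in D).
    by have [K Ks yK] := hD y yD; exists K; rewrite ?inE ?Ks ?orbT.
  by exists C; rewrite ?in_cons ?eqxx // in_setD yD.
- by rewrite cards0 add0n big_cons -/C; move: kM; rewrite missM add0n => <-;
  rewrite mul2n doubleK; nu_lia.
move=> K; rewrite setD0 inE => /orP[/eqP->|Ks].
  by split=> [|q oC qC]; [apply: subsetDl|move: oC; rewrite -kM missM mul2n odd_double].
have sKD := hK K Ks; split=> [|q _ /(subsetP sKD)]; first exact: subset_trans DU.
by rewrite inE => /andP[_ /eqP].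
Qed.
End Matching.

(** * Weighted graphs of bounded degree *)

Lemma half_pairs (b : bool) h m : b + h.*2 = m -> (m * m.-1)./2 <= h * (2 * h).+1.
Proof.
move=> def_m; have := odd_double_half (m * m.-1).
have: m * m.-1 <= 2 * (h * (2 * h).+1) by rewrite -def_m -mul2n; case: b {def_m} => /=; nia.
move: (_ * _.-1) (_ * _.+1) => x y; move: (odd x) (x./2) => c z; lia.
Qed.

Section Weighted.
Variables (V : finType) (E : {set {set V}}) (W : {set V} -> nat).
Hypothesis E2 : forall e, e \in E -> #|e| = 2.
Implicit Types (U K : {set V}) (x y : V).

Definition wdeg y := \sum_(e in E | y \in e) W e.
Definition win K := \sum_(e in E | e \subset K) W e.
Definition wdeg_in K y := \sum_(e in E | (y \in e) && (e \subset K)) W e.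

Lemma wdeg_in_le K y : wdeg_in K y <= wdeg y.
Proof.
rewrite /wdeg_in /wdeg (bigID (fun e : {set V} => e \subset K) [pred e in E | y \in e]) /=.
by under [X in X + _]eq_bigl do rewrite -andbA; apply: leq_addr.
Qed.

Lemma handshake K : 2 * win K = \sum_(y in K) wdeg_in K y.
Proof.
transitivity (\sum_(e in E | e \subset K) \sum_(y in e) W e).
  rewrite /win big_distrr; apply: eq_bigr => e /andP[eE _] /=.
  by rewrite sum_nat_const E2.
rewrite (exchange_big_dep (mem K)) /=; last by move=> e y /andP[_ /subsetP]; apply.
apply: eq_bigr => y yK; apply: eq_bigl => e.
by rewrite -andbA [(e \subset K) && _]andbC.
Qed.

Lemma win_pairs K c : (forall e, e \in E -> W e <= c) -> win K <= c * 'C(#|K|, 2).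
Proof.
move=> Wc; rewrite -cards_draws -sum1_card big_distrr /= /win.
under [X in _ <= X]eq_bigl do rewrite inE.
under [X in _ <= X]eq_bigr do rewrite muln1.
rewrite [X in _ <= X]big_mkcond [X in X <= _]big_mkcond /=; apply: leq_sum => e _.
by case: ifP => // /andP[eE eK]; rewrite eK E2 // Wc.
Qed.

Lemma win_even K D : (forall y, wdeg y <= D) -> 2 * win K <= D * #|K|.
Proof.
move=> hD; rewrite handshake mulnC -sum_nat_const; apply: leq_sum => y _.
exact: leq_trans (wdeg_in_le K y) (hD y).
Qed.

Lemma win_split U K : win U <= \sum_(y in U :\: K) wdeg y + win (U :&: K).
Proof.
rewrite /win (bigID (fun e : {set V} => e \subset K)) /= addnC; apply: leq_add; last first.
  by apply: eq_leq; apply: eq_bigl => e; rewrite subsetI andbA.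
rewrite /wdeg (exchange_big_dep (mem E)) /=; last by move=> y e _ /andP[].
rewrite [X in _ <= X]big_mkcond [X in X <= _]big_mkcond /=; apply: leq_sum => e _.
case: ifP => // /andP[/andP[eE eU] /subsetPn[y ye yK]]; rewrite eE.
rewrite (bigD1 y) ?leq_addr //=.
by rewrite inE yK (subsetP eU y ye) ?eE.
Qed.

(* Odd components with at least 2 * h0 + 1 vertices are the only ones on which the
   weight may exceed D times the number of matching edges. *)
Lemma structure_bound U D ex h0 :
  (forall y, wdeg y <= D) ->
  (forall K, K \subset U -> #|K|./2 <= nu E U ->
     (odd #|K| -> forall q, q \in K -> nu E (U :\ q) = nu E U) ->
     (odd #|K| -> forall x, x \in U -> nu E (U :\ x) != nu E U -> #|K|./2 < nu E U) ->
     win K <= D * #|K|./2 + (if odd #|K| && (h0 <= #|K|./2) then ex else 0)) ->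
  exists2 t, t * h0 <= nu E U & win U <= D * nu E U + ex * t.
Proof.
move=> hD hK; have [A [s [sA hE hU hle hs]]] := gallai_edmonds E2 U.
pose big (K : {set V}) := odd #|K| && (h0 <= #|K|./2).
have sumle (r : seq {set V}) (F : {set V} -> nat) K : K \in r -> F K <= \sum_(L <- r) F L.
  by move=> Kr; rewrite (big_rem K Kr) leq_addr.
exists (count big s).
  apply: leq_trans hle; apply: leq_trans (leq_addl _ _).
  rewrite -sum1_count big_distrl /= big_mkcond /=; apply: leq_sum => K _.
  by case: ifP => // /andP[_]; rewrite mul1n.
have w1 : win U <= D * #|A| + \sum_(K <- s) win K.
  apply: leq_trans (win_split U (~: A)) _; apply: leq_add.
    rewrite mulnC -sum_nat_const; have -> : U :\: ~: A = A.
      by rewrite setDE setCK; apply/setIidPr.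
    by apply: leq_sum => y _.
  rewrite -setDE {1}/win; under [X in _ <= X]eq_bigr do rewrite /win big_mkcond.
  rewrite exchange_big /= big_mkcond /=; apply: leq_sum => e _.
  case: ifP => // /andP[eE eU]; have [K Ks eK] := hE e eE eU.
  by apply: leq_trans (sumle s _ K Ks); rewrite eE eK.
apply: leq_trans w1 _.
apply: leq_trans (_ : D * #|A| + (D * (\sum_(K <- s) #|K|./2) + ex * count big s) <= _);
  last by rewrite addnA -mulnDr leq_add2r leq_mul2l hle orbT.
rewrite leq_add2l -sum1_count !big_distrr /= [X in _ + X]big_mkcond /= -big_split /=.
rewrite big_seq [X in _ <= X]big_seq; apply: leq_sum => K Ks; have [sK oddK] := hs K Ks.
have Kle : #|K|./2 <= nu E U.
  apply: leq_trans hle; apply: leq_trans (leq_addl _ _).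
  exact: (sumle s (fun K : {set V} => #|K|./2)).
apply: leq_trans (hK K _ Kle _ _) _.
- by apply: subset_trans sK _; apply: subsetDl.
- by move=> oK q qK; apply: oddK.
(* An essential vertex lies in [A] or in an even block; either one contributes at least 1 to the sum
   besides [K]. *)
- move=> oK x xU xess; apply: leq_trans hle.
  case: (hU x xU) => [xA|[L Ls xL]].
    rewrite (cardsD1 x A) xA -addnA add1n ltnS; apply: leq_trans (leq_addl _ _).
    exact: (sumle s (fun K : {set V} => #|K|./2)).
  have [_ oddL] := hs L Ls; have eL : ~~ odd #|L|.
    by apply: contra xess => oL; rewrite oddL.
  have nKL : K != L by apply: contraNneq eL => <-.
  apply: leq_trans (leq_addl _ _); rewrite (big_rem L Ls) /=.
  have Kr : K \in rem L s.
    move: Ks; rewrite (perm_mem (perm_to_rem Ls)) inE => /orP[/eqP h|//].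
    by rewrite h eqxx in nKL.
  have := sumle (rem L s) (fun K : {set V} => #|K|./2) K Kr => /=.
  have : 0 < #|L| by apply/card_gt0P; exists x.
  have := odd_double_half #|L|; rewrite (negPf eL) add0n.
  move: (\sum_(j <- rem L s) _) (#|K|) (#|L|) => *; lia.
- by rewrite leq_add2l /big; case: ifP; rewrite ?muln1.
Qed.

(** A block has at most 2 nu + 1 vertices, so even a complete block with all weights c stays within
    D per matching edge and no block has an excess. *)
Lemma small_nu_bound U D c : (forall y, wdeg y <= D) ->
  (forall e, e \in E -> W e <= c) -> c * (2 * nu E U).+1 <= D ->
  win U <= D * nu E U.
Proof.
move=> hD Wc hc; have [|t _] := @structure_bound U D 0 0 hD; last by rewrite mul0n addn0.
move=> K _ Kle _ _; rewrite if_same addn0; apply: leq_trans (win_pairs _ Wc) _.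
rewrite bin2; have := odd_double_half #|K|.
move: #|K| #|K|./2 (nu E U) (odd _) Kle hc => m h v b Kle hc def_m.
have h1 := half_pairs def_m.
have h2 : c * (2 * h).+1 <= D by apply: leq_trans hc; rewrite leq_mul2l; apply/orP; right; lia.
apply: leq_trans (_ : c * (h * (2 * h).+1) <= _); first by rewrite leq_mul2l h1 orbT.
by rewrite mulnCA [D * _]mulnC leq_mul2l h2 orbT.
Qed.

(** Below the cutoff an odd block has at most d vertices and counting pairs suffices. Above it, half
    the degree sum exceeds 12d per matching edge by the half share 6d of the odd vertex. *)
Lemma component_bound K d : (forall y, wdeg y <= 12 * d) ->
  (forall e, e \in E -> W e <= 12) ->
  win K <= 12 * d * #|K|./2 + (if odd #|K| && (uphalf d <= #|K|./2) then 6 * d else 0).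
Proof.
move=> hD Wc.
have := win_pairs K Wc; have := win_even K hD; rewrite bin2.
have := odd_double_half #|K|.
move: #|K| #|K|./2 (odd _) (win K) => m h b w def_m h1 h2.
case: ifP => [/andP[ob hd]|nbig]; first by rewrite ob in def_m; nia.
case: b def_m nbig => /= [def_m nbig|def_m _]; last by nia.
have h3 : (m * m.-1)./2 <= h * (2 * h).+1 by apply: (@half_pairs true).
have h4 : (2 * h).+1 <= d by rewrite uphalfE -divn2 in nbig; lia.
nia.
Qed.

Lemma degree_bound U d : (forall y, wdeg y <= 12 * d) ->
  (forall e, e \in E -> W e <= 12) ->
  exists2 t, t * uphalf d <= nu E U & win U <= 12 * d * nu E U + 6 * d * t.
Proof.
by move=> hD Wc; apply: structure_bound => // K _ _ _ _; apply: component_bound.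
Qed.
End Weighted.

(** * Stars *)

Section Stars.
Variable V : finType.
Implicit Types (x : V) (M : {set {set V}}).

(* M is a matching in the link of x: the edges x |: p, p in M, form a star. *)
Definition smatch x M :=
  [&& trivIset M, [forall p in M, #|p| == 2] & x \notin cover M].

Lemma smatchP x M : reflect
  [/\ forall (p q : {set V}) y, p \in M -> q \in M -> y \in p -> y \in q -> p = q,
      forall p : {set V}, p \in M -> #|p| = 2 &
      forall p : {set V}, p \in M -> x \notin p] (smatch x M).
Proof.
apply: (iffP and3P) => [[/trivIsetP tM /forall_inP h2 xM]|[tM h2 xM]]; split.
- move=> p q y pM qM yp yq; apply/eqP/negPn/negP => npq.
  by have /pred0P/(_ y) := tM p q pM qM npq; rewrite /= yp yq.
- by move=> p /h2/eqP.
- by move=> p pM; apply: contra xM => xp; apply/bigcupP; exists p.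
- apply/trivIsetP => p q pM qM npq; apply/pred0P => y; apply/negP => /andP[yp yq].
  by rewrite (tM p q y pM qM yp yq) eqxx in npq.
- by apply/forall_inP => p /h2->.
- by apply/bigcupP => -[p /xM/negPf->].
Qed.

Lemma smatch_sub x M (N : {set {set V}}) : N \subset M -> smatch x M -> smatch x N.
Proof.
move=> /subsetP sNM /smatchP[h1 h2 h3]; apply/smatchP; split.
- by move=> p q y /sNM pM /sNM qM; apply: h1.
- by move=> p /sNM/h2.
- by move=> p /sNM/h3.
Qed.

Lemma card_star_edge x (p : {set V}) : #|p| = 2 -> x \notin p -> #|x |: p| = 3.
Proof. by move=> p2 xp; rewrite cardsU1 xp p2. Qed.

Lemma setU1_inj x (p q : {set V}) : x \notin p -> x \notin q -> x |: p = x |: q -> p = q.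
Proof. by move=> xp xq e; rewrite -(setU1K xp) e setU1K. Qed.

Lemma copy_smatch k (f : option ('I_k * bool) -> V) : injective f ->
  exists x M, [/\ smatch x M, #|M| = k & hcopy f (star k) = [set x |: p | p in M]].
Proof.
move=> injf; pose p (i : 'I_k) := [set f (Some (i, false)); f (Some (i, true))].
have pE i y : y \in p i -> exists b, y = f (Some (i, b)).
  by rewrite !inE => /orP[] /eqP->; [exists false|exists true].
have pinj : injective p.
  move=> i j e; have : f (Some (i, false)) \in p j by rewrite -e !inE eqxx.
  by move/pE => [b /injf[]].
exists (f None), [set p i | i in 'I_k]; split.
- apply/smatchP; split.
  + move=> _ _ y /imsetP[i _ ->] /imsetP[j _ ->] /pE[b ->] /pE[b' /injf[-> _]] //.
  + by move=> _ /imsetP[i _ ->]; rewrite cards2 (inj_eq injf) (inj_eq Some_inj) xpair_eqE andbF.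
  + by move=> _ /imsetP[i _ ->]; apply/negP => /pE[b /injf].
- by rewrite card_imset // card_ord.
- rewrite /hcopy /star -!imset_comp; apply: eq_imset => i /=.
  by rewrite /star_edge !imsetU !imset_set1 /p setUA.
Qed.

Lemma smatch_copy x M : smatch x M ->
  exists2 f : {ffun option ('I_#|M| * bool) -> V},
    injectiveb f & hcopy f (star #|M|) = [set x |: p | p in M].
Proof.
move=> /smatchP[h1 h2 h3].
have el (p : {set V}) : exists g : bool -> V, p \in M -> injective g /\ p = [set g false; g true].
  have [pM|] := boolP (p \in M); last by exists (fun=> x).
  have /eqP/cards2P[u [v [nuv ->]]] := h2 p pM.
  exists (fun b : bool => if b then v else u) => _; split=> // -[] [] //= e.
    by rewrite e eqxx in nuv.
  by rewrite e eqxx in nuv.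
have {el}[g gP] := fin_all_exists el.
pose P (i : 'I_#|M|) : {set V} := enum_val i.
have PM i : P i \in M by apply: enum_valP.
have gin i b : g (P i) b \in P i.
  have [_ e] := gP _ (PM i).
  have : g (P i) b \in [set g (P i) false; g (P i) true] by case: b; rewrite !inE eqxx ?orbT.
  by rewrite -e.
pose F o := if o is Some ib then g (P ib.1) ib.2 else x.
have injF : injective F.
  have nx i b : x <> g (P i) b by move=> e; have := h3 _ (PM i); rewrite {1}e gin.
  move=> [[i b]|] [[j c]|] //= e; last 2 first.
  - by case: (nx i b).
  - by case: (nx j c).
  have eij : P i = P j by apply: (h1 _ _ (g (P i) b)); rewrite ?PM ?gin // e gin.
  have ij : i = j by apply: enum_val_inj.
  by subst j; have [inj _] := gP _ (PM i); rewrite (inj _ _ e).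
exists [ffun o => F o].
  by apply/injectiveP => a b; rewrite !ffunE; apply: injF.
rewrite /hcopy /star -imset_comp.
have -> : [set x |: p | p in M] = [set x |: P i | i in 'I_#|M|].
  apply/setP => e; apply/imsetP/imsetP => [[p pM ->]|[i _ ->]]; last by exists (P i).
  by exists (enum_rank_in pM p); rewrite // /P enum_rankK_in.
apply: eq_imset => i /=; rewrite /star_edge !imsetU !imset_set1 !ffunE /= -setUA.
by have [_ e] := gP _ (PM i); rewrite -e.
Qed.

Lemma contains_starP k (H : {set {set V}}) : reflect
  (exists x M, [/\ smatch x M, #|M| = k & forall p : {set V}, p \in M -> x |: p \in H])
  (contains_copy H (star k)).
Proof.
apply: (iffP existsP) => [[f /andP[/injectiveP injf sH]]|[x [M [sM cM MH]]]].
  have [x [M [sM cM e]]] := copy_smatch injf; exists x, M; split=> // p pM.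
  by apply: (subsetP sH); rewrite e; apply/imsetP; exists p.
subst k; have [f injf e] := smatch_copy sM; exists f; rewrite injf /= e.
by apply/subsetP => _ /imsetP[p pM ->]; apply: MH.
Qed.
End Stars.

Lemma rainbow_starP n t k (c : {ffun {set 'I_n} -> 'I_t}) : reflect
  (exists x M, [/\ smatch x M, #|M| = k & {in M &, injective (fun p => c (x |: p))}])
  (has_rainbow_copy c (star k)).
Proof.
apply: (iffP existsP) => [[f /and3P[/injectiveP injf _ rb]]|[x [M [sM cM cinj]]]].
  have [x [M [sM cM e]]] := copy_smatch injf; exists x, M; split=> // p q pM qM epq.
  have /smatchP[_ _ h3] := sM.
  apply: (@setU1_inj _ x); rewrite ?h3 //; apply/eqP.
  have inM r : r \in M -> x |: r \in hcopy f (star k) by move=> rM; rewrite e; apply/imsetP;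
    exists r.
  have /forall_inP/(_ _ (inM p pM))/forall_inP/(_ _ (inM q qM))/implyP := rb.
  by apply; apply/eqP.
subst k; have [f injf e] := smatch_copy sM; exists f; rewrite injf /= e.
have /smatchP[_ h2 h3] := sM; apply/andP; split.
  by apply/subsetP => _ /imsetP[p pM ->]; rewrite inE card_star_edge ?h2 ?h3.
apply/forall_inP => _ /imsetP[p pM ->]; apply/forall_inP => _ /imsetP[q qM ->].
by apply/implyP => /eqP epq; rewrite (cinj p q).
Qed.

(** * Lower bounds for the Turan number *)

Lemma star_turan_ge n k (H : {set {set 'I_n}}) :
  H \subset complete3 'I_n -> ~~ contains_copy H (star k) -> #|H| <= star_turan n k.
Proof. by move=> sH nH; apply: leq_bigmax_cond; rewrite sH. Qed.

Section Blowup.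
Variables (V : finType) (Q : {set {set V}}) (d : nat).
Hypothesis Q2 : forall q : {set V}, q \in Q -> #|q| = 2.
Hypothesis Qdeg : forall x, #|[set q in Q | x \in q]| <= d.
Hypothesis Qmatch : forall M : {set {set V}}, M \subset Q -> trivIset M -> #|M| <= d.

Definition blowup := [set z.2 |: z.1 | z in setX Q (~: cover Q)].

Lemma sub_coverQ (q : {set V}) : q \in Q -> q \subset cover Q.
Proof. by move=> qQ; apply: (bigcup_sup q). Qed.

Lemma blowup_trace (q : {set V}) w : q \in Q -> w \notin cover Q -> (w |: q) :&: cover Q = q.
Proof.
move=> qQ wT; apply/setP => y; rewrite !inE; have [->|_] /= := eqVneq y w.
  by rewrite (negPf wT); apply/esym; apply: contraNF wT; apply: (subsetP (sub_coverQ qQ)).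
by have [yq|//] := boolP (y \in q); rewrite (subsetP (sub_coverQ qQ)).
Qed.

Lemma card_blowup : #|blowup| = #|Q| * (#|V| - #|cover Q|).
Proof.
rewrite card_in_imset ?cardsX 1?[#|~: _|]cardsCs ?setCK // => -[q w] [q' w'].
rewrite !in_setX !in_setC /= => /andP[qQ wT] /andP[qQ' wT'] e.
have eq : q = q' by rewrite -(blowup_trace qQ wT) e blowup_trace.
subst q'; congr pair; have : w \in w' |: q by rewrite -e !inE eqxx.
by rewrite !inE => /orP[/eqP//|/(subsetP (sub_coverQ qQ))]; rewrite (negPf wT).
Qed.

Lemma blowup_sub : blowup \subset complete3 V.
Proof.
apply/subsetP => _ /imsetP[[q w] /setXP[qQ wT] ->]; rewrite /= in qQ wT *.
rewrite inE cardsU1 Q2 // (_ : w \notin q) //.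
by move: wT; rewrite inE; apply: contra; apply: (subsetP (sub_coverQ qQ)).
Qed.

(** If the core is outside [cover Q], the star is a matching in [Q]. If it is inside, distinct star
    edges have distinct traces on [cover Q], which are edges of [Q] at the core. *)
Lemma blowup_free : ~~ contains_copy blowup (star d.+1).
Proof.
apply/contains_starP => -[x [M [sM cM MH]]]; have /smatchP[h1 h2 h3] := sM.
have edge (p : {set V}) : p \in M -> exists q w, [/\ q \in Q, w \notin cover Q & x |: p = w |: q].
  by move=> /MH /imsetP[[q w] /setXP[/= qQ]]; rewrite inE => wT ->; exists q, w.
have [xT|xT] := boolP (x \in cover Q); last first.
  have sMQ : M \subset Q.
    apply/subsetP => p pM; have [q [w [qQ wT e]]] := edge p pM.
    have xq : x \notin q by apply: contra xT; apply: (subsetP (sub_coverQ qQ)).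
    have : x \in w |: q by rewrite -e !inE eqxx.
    rewrite !inE (negPf xq) orbF => /eqP xw; subst w.
    by rewrite (setU1_inj (h3 p pM) xq e).
  have tM : trivIset M by case/and3P: sM.
  by have := Qmatch sMQ tM; rewrite cM ltnn.
suff : #|M| <= d by rewrite cM ltnn.
apply: leq_trans (Qdeg x); pose g (p : {set V}) := (x |: p) :&: cover Q.
have gQ p : p \in M -> g p \in Q /\ x \in g p.
  move=> pM; have [q [w [qQ wT e]]] := edge p pM; rewrite /g e blowup_trace //; split=> //.
  have : x \in w |: q by rewrite -e !inE eqxx.
  by rewrite !inE => /orP[/eqP xw|//]; rewrite -xw xT in wT.
rewrite -(card_in_imset (_ : {in M &, injective g})).
  apply/subset_leq_card/subsetP => _ /imsetP[p /gQ[gp xg] ->].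
  by rewrite inE gp xg.
move=> p q pM qM e; have [gp xg] := gQ p pM.
have /eqP/cards2P[u [v [nuv guv]]] := Q2 gp.
have [y ygp nyx] : exists2 y, y \in g p & y != x.
  have [ux|ux] := eqVneq u x; last by exists u; rewrite // guv !inE eqxx.
  by exists v; rewrite ?guv ?inE ?eqxx ?orbT // -ux eq_sym.
have yq : y \in g q by rewrite -e.
move: ygp yq; rewrite !inE (negPf nyx) /= => /andP[yp _] /andP[yq _].
exact: (h1 p q y).
Qed.
End Blowup.

(** * Extremal graphs for the Chvatal-Hanson bound *)

Section PairSets.
Variable V : finType.
Implicit Types (A B : {set V}).

Definition pairs A := [set p : {set V} | p \subset A & #|p| == 2].

Lemma card_pairs A : #|pairs A| = 'C(#|A|, 2).
Proof. by rewrite cards_draws. Qed.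

Lemma pairs_other A p x : p \in pairs A -> x \in p ->
  exists2 y, y \in A :\ x & p = [set x; y].
Proof.
rewrite inE => /andP[pA /cards2P[u [v [nuv def_p]]]]; subst p.
rewrite in_set2 => /orP[] /eqP->.
  exists v; last by [].
  by rewrite !inE eq_sym nuv (subsetP pA) // !inE eqxx orbT.
by exists u; rewrite ?inE ?nuv ?(subsetP pA) ?inE ?eqxx // setUC.
Qed.

Lemma star_set_le (Q : {set {set V}}) (N : {set V}) x :
  (forall q : {set V}, q \in Q -> x \in q -> exists2 y, y \in N & q = [set x; y]) ->
  #|[set q in Q | x \in q]| <= #|N|.
Proof.
move=> h; apply: leq_trans (leq_imset_card (fun y => [set x; y]) (mem N)).
apply/subset_leq_card/subsetP => q; rewrite inE => /andP[qQ xq].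
by have [y yN ->] := h q qQ xq; apply/imsetP; exists y.
Qed.

Lemma card_trivIset2 (M : {set {set V}}) (T : {set V}) : trivIset M ->
  (forall p : {set V}, p \in M -> #|p| = 2) -> cover M \subset T -> 2 * #|M| <= #|T|.
Proof.
move=> /eqP tM M2 /leq_cards; rewrite -tM (eq_bigr (fun=> 2)) //.
by rewrite sum_nat_const mulnC.
Qed.
End PairSets.

Section TwoCliques.
Variables (V : finType) (A B : {set V}) (d : nat).
Hypotheses (cA : #|A| = d.+1) (cB : #|B| = d.+1) (dAB : [disjoint A & B]) (ed : ~~ odd d).

(** Each clique has an odd number d + 1 of vertices, so a matching has at most d/2 edges in it. *)
Lemma two_cliques_bound n : n = #|V| ->
  exists H : {set {set V}}, [/\ H \subset complete3 V, ~~ contains_copy H (star d.+1) &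
    d * d.+1 * (n - 2 * d.+1) <= #|H|].
Proof.
move=> def_n; pose Q := pairs A :|: pairs B.
have Q2 (q : {set V}) : q \in Q -> #|q| = 2 by rewrite !inE => /orP[] /andP[_ /eqP].
have clique (C : {set V}) : #|C| = d.+1 -> forall x, x \in C -> #|C :\ x| = d.
  by move=> cC x xC; move: cC; rewrite (cardsD1 x) xC => -[].
have Qdeg x : #|[set q in Q | x \in q]| <= d.
  have [xA|xA] := boolP (x \in A).
    rewrite -(clique A cA x xA); apply: star_set_le => q /setUP[]qA xq.
      exact: pairs_other qA xq.
    move: qA; rewrite inE => /andP[/subsetP/(_ x xq) xB _].
    by have /pred0P/(_ x) := dAB; rewrite /= xA xB.
  have [xB|xB] := boolP (x \in B); last first.
    rewrite leqNgt; apply/negP => /(leq_ltn_trans (leq0n _)) /card_gt0P[q].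
    by rewrite !inE => /andP[/orP[] /andP[/subsetP h _] /h]; rewrite ?(negPf xA) ?(negPf xB).
  rewrite -(clique B cB x xB); apply: star_set_le => q /setUP[]qA xq;
    last exact: pairs_other qA xq.
  by move: qA; rewrite inE => /andP[/subsetP/(_ x xq) xA' _]; rewrite xA' in xA.
have Qmatch (M : {set {set V}}) : M \subset Q -> trivIset M -> #|M| <= d.
  move=> sM tM; pose MA := M :&: pairs A; pose MB := M :&: pairs B.
  have part (C : {set V}) : #|C| = d.+1 -> 2 * #|M :&: pairs C| <= d.+1.
    move=> <-; apply: card_trivIset2; first by apply: trivIsetS tM; apply: subsetIl.
      by move=> p; rewrite !inE => /and3P[_ _ /eqP].
    by apply/bigcupsP => p; rewrite !inE => /and3P[_ ].
  have : #|M| <= #|MA| + #|MB|.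
    rewrite -cardsUI; apply: leq_trans (leq_addr _ _); apply: leq_cards.
    by rewrite -setIUr; apply/subsetP => p pM; rewrite inE pM (subsetP sM).
  by have := part A cA; have := part B cB; rewrite -/MA -/MB; have := ed; card_lia.
exists (blowup Q); split; [exact: blowup_sub|exact: blowup_free|].
have cQ : #|Q| = d * d.+1.
  rewrite cardsU (_ : pairs A :&: pairs B = set0) ?cards0 ?subn0 ?card_pairs ?cA ?cB.
    by rewrite addnn bin2 /= halfK oddM /= andNb subn0 mulnC.
  apply/setP => p; rewrite !inE; apply/negP => /andP[/andP[/subsetP pA p2] /andP[/subsetP pB _]].
  have : 0 < #|p| by rewrite (eqP p2).
  case/card_gt0P => x xp; have /pred0P/(_ x) := dAB.
  by rewrite /= pA ?pB.
rewrite card_blowup // cQ -def_n leq_mul2l; apply/orP; right; apply: leq_sub2l.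
apply: leq_trans (_ : #|A :|: B| <= _).
  apply: leq_cards; apply/bigcupsP => q; rewrite !inE => /orP[] /andP[qA _].
    by apply: subset_trans qA _; apply: subsetUl.
  by apply: subset_trans qA _; apply: subsetUr.
by rewrite mul2n -addnn -{1}cA -cB cardsU leq_subr.
Qed.
End TwoCliques.

(* From disjoint cliques on d+1 and d vertices, replace a matching of r edges of
   the first one by 2r edges between the two cliques. *)
Section NearRegular.
Variables (V : finType) (d r : nat) (a b : nat -> V).
Hypotheses (def_d : d = 2 * r + 1)
  (ainj : forall i j, i < d.+1 -> j < d.+1 -> a i = a j -> i = j)
  (binj : forall i j, i < d -> j < d -> b i = b j -> i = j)
  (nab : forall i j, i < d.+1 -> j < d -> a i != b j).

Let A := [set a i | i : 'I_d.+1].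
Let B := [set b i | i : 'I_d].
Let M1 := [set [set a (2 * i); a (2 * i + 1)] | i : 'I_r].
Let M2 := [set [set a i; b i] | i : 'I_(2 * r)].
Let Q := (pairs A :\: M1) :|: pairs B :|: M2.

Lemma nabF i j : i < d.+1 -> j < d -> a i <> b j.
Proof. by move=> hi hj; apply/eqP/nab. Qed.

Lemma aA i : i < d.+1 -> a i \in A.
Proof. by move=> h; apply/imsetP; exists (Ordinal h). Qed.

Lemma bB i : i < d -> b i \in B.
Proof. by move=> h; apply/imsetP; exists (Ordinal h). Qed.

Lemma mem_A x : x \in A -> exists2 i, i < d.+1 & x = a i.
Proof. by case/imsetP => i _ ->; exists i. Qed.

Lemma mem_B x : x \in B -> exists2 i, i < d & x = b i.
Proof. by case/imsetP => i _ ->; exists i. Qed.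

Lemma AB0 x : x \in A -> x \in B -> False.
Proof.
move=> /mem_A[i hi ->] /mem_B[j hj e].
by have := nab hi hj; rewrite e eqxx.
Qed.

Lemma nr_cA : #|A| = d.+1.
Proof. by rewrite card_imset ?card_ord // => i j /ainj h; apply/val_inj/h. Qed.

Lemma nr_cB : #|B| = d.
Proof. by rewrite card_imset ?card_ord // => i j /binj h; apply/val_inj/h. Qed.

Lemma nr_cM1 : #|M1| = r.
Proof.
rewrite card_imset ?card_ord // => i j e; have := ltn_ord i; have := ltn_ord j => hj hi.
have : a (2 * i) \in [set a (2 * j); a (2 * j + 1)] by rewrite -e !inE eqxx.
rewrite !inE => /orP[] /eqP/ainj h.
  by apply/val_inj => /=; have e2 : 2 * i = 2 * j by [apply: h; lia]; lia.
by have e2 : 2 * i = 2 * j + 1 by [apply: h; lia]; lia.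
Qed.

Lemma nr_cM2 : #|M2| = 2 * r.
Proof.
rewrite card_imset ?card_ord // => i j e; have := ltn_ord i; have := ltn_ord j => hj hi.
have : a i \in [set a j; b j] by rewrite -e !inE eqxx.
rewrite !inE => /orP[] /eqP h; first by apply/val_inj; apply: ainj h; lia.
by case: (@nabF i j) => //; lia.
Qed.

Lemma nr_M1A : M1 \subset pairs A.
Proof.
apply/subsetP => _ /imsetP[i _ ->]; have := ltn_ord i => hi.
rewrite inE subUset !sub1set !aA ?cards2 /=; try lia.
by rewrite (_ : a (2 * i) != a (2 * i + 1)) //; apply/eqP => /ainj; lia.
Qed.

Lemma nr_card : #|Q| = d * d + r.
Proof.
have d1 : (pairs A :\: M1) :&: pairs B = set0.
  apply/setP => p; rewrite !inE;
    apply/negP => /andP[/and3P[_ /subsetP pA p2] /andP[/subsetP pB _]].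
  have : 0 < #|p| by rewrite (eqP p2).
  by case/card_gt0P => x xp; apply: (@AB0 x); [apply: pA|apply: pB].
have d2 : ((pairs A :\: M1) :|: pairs B) :&: M2 = set0.
  apply/setP => p; rewrite 2!inE in_set0; apply/negP => /andP[h /imsetP[i _ def_p]].
  have := ltn_ord i => hi; have hia : a i \in A by apply: aA; lia.
  have hib : b i \in B by apply: bB; lia.
  case/orP: h; rewrite !inE.
    case/and3P=> _ /subsetP/(_ (b i)) h _; apply: (AB0 _ hib); apply: h.
    by rewrite def_p !inE eqxx orbT.
  case/andP=> /subsetP/(_ (a i)) h _; apply: (AB0 hia); apply: h.
  by rewrite def_p !inE eqxx.
rewrite cardsU d2 cardsU d1 !cards0 !subn0 cardsD (setIidPr nr_M1A) nr_cM1 nr_cM2.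
have h1 : 'C(d.+1, 2) = (r + 1) * d.
  by rewrite bin2 (_ : d.+1 * d.+1.-1 = ((r + 1) * d).*2) ?doubleK // -mul2n /= def_d; nia.
have h2 : 'C(d, 2) = r * d.
  by rewrite bin2 (_ : d * d.-1 = (r * d).*2) ?doubleK // -mul2n def_d addn1 /=; nia.
by rewrite !card_pairs nr_cA nr_cB h1 h2 def_d; nia.
Qed.

Lemma nr_Q2 (q : {set V}) : q \in Q -> #|q| = 2.
Proof.
rewrite 2!inE => /orP[/orP[]|].
- by rewrite !inE => /and3P[_ _ /eqP].
- by rewrite !inE => /andP[_ /eqP].
case/imsetP => i _ ->; rewrite cards2 nab //; have := ltn_ord i; lia.
Qed.

Lemma nr_cover : cover Q \subset A :|: B.
Proof.
apply/bigcupsP => q; rewrite 2!inE => /orP[/orP[]|].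
- by rewrite !inE => /and3P[_ qA _]; apply: subset_trans qA (subsetUl _ _).
- by rewrite !inE => /andP[qB _]; apply: subset_trans qB (subsetUr _ _).
case/imsetP => i _ ->; have := ltn_ord i => hi.
by rewrite subUset !sub1set !inE aA ?bB ?orbT //; lia.
Qed.

Lemma nr_deg x : #|[set q in Q | x \in q]| <= d.
Proof.
have [xA|nxA] := boolP (x \in A).
  have [j hj def_x] := mem_A xA.
  have offB (q : {set V}) : q \in pairs B -> x \in q -> False.
    by rewrite inE => /andP[/subsetP qB _] /qB; apply: AB0.
  have onM2 q : q \in M2 -> x \in q -> j < 2 * r /\ q = [set x; b j].
    case/imsetP => i _ ->; have := ltn_ord i => hi; rewrite def_x !inE => /orP[] /eqP h.
      have <- : j = i by apply: ainj h; lia.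
      by split=> //; have -> : j = i by [apply: ainj h; lia].
    by case: (@nabF j i) => //; lia.
  have [hjr|hjr] := ltnP j (2 * r); last first.
    have -> : d = #|A :\ x| by have := nr_cA; rewrite (cardsD1 x) xA => -[].
    apply: star_set_le => q; rewrite 2!inE => /orP[/orP[/setDP[qA _]|qB]|qM] xq.
    - exact: pairs_other qA xq.
    - by case: (offB q).
    - by have [] := onM2 q qM xq; lia.
  (* [a j'] is the partner of x in the removed matching [M1]; at x, the cross edge to [b j] replaces
     the edge to it. *)
  pose j' := if odd j then j.-1 else j.+1.
  have hj' : j' < d.+1 by rewrite /j'; case: ifP; lia.
  have njj : a j' != x by rewrite def_x; apply/eqP => /ainj; rewrite /j'; case: ifP; lia.
  have pM1 : [set x; a j'] \in M1.
    have hh : j./2 < r by rewrite -divn2; lia.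
    apply/imsetP; exists (Ordinal hh) => //=; have := odd_double_half j; rewrite -mul2n => e.
    rewrite def_x /j'; move: e; case: (odd j) => /= e; last by rewrite add0n in e;
      rewrite e addn1.
    have -> : 2 * j./2 = j.-1 by lia.
    by rewrite setUC (_ : j.-1 + 1 = j) //; lia.
  have -> : d = #|b j |: (A :\ x :\ a j')|.
    rewrite cardsU1 !inE (_ : b j \in A = false) ?andbF /=; last first.
      by apply/negP => h; apply: (AB0 h); apply: bB; lia.
    have := nr_cA; rewrite (cardsD1 x) xA (cardsD1 (a j')) !inE njj aA //=; lia.
  apply: star_set_le => q; rewrite 2!inE => /orP[/orP[/setDP[qA qM1]|qB]|qM] xq.
  - have [y yA def_q] := pairs_other qA xq; exists y => //.
    rewrite 2!inE [y \in _ :\ a j']inE yA andbT; apply/orP; right; rewrite inE.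
    by apply: contraNneq qM1 => yj; rewrite def_q yj.
  - by case: (offB q).
  - by have [_ ->] := onM2 q qM xq; exists (b j); rewrite ?inE ?eqxx.
have [xB|nxB] := boolP (x \in B); last first.
  rewrite leqNgt; apply/negP => /(leq_ltn_trans (leq0n _)) /card_gt0P[q].
  rewrite inE => /andP[qQ xq]; have : x \in cover Q by apply/bigcupP; exists q.
  by move/(subsetP nr_cover); rewrite inE (negPf nxA) (negPf nxB).
have [j hj def_x] := mem_B xB.
have -> : d = #|a j |: (B :\ x)|.
  have := nr_cB; rewrite (cardsD1 x) xB cardsU1 !inE (_ : a j \in B = false) ?andbF //=.
  by apply/negP => h; apply: (AB0 _ h); apply: aA; lia.
apply: star_set_le => q; rewrite 2!inE => /orP[/orP[/setDP[qA _]|qB]|qM] xq.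
- by move: qA; rewrite inE => /andP[/subsetP/(_ x xq)]; rewrite (negPf nxA).
- by have [y yB ->] := pairs_other qB xq; exists y; rewrite // inE yB orbT.
- case/imsetP: qM xq => i _ ->; have := ltn_ord i => hi; rewrite def_x !inE => /orP[] /eqP h.
    by case: (@nabF i j) => //; lia.
  have <- : j = i by apply: binj h; lia.
  by exists (a j); rewrite ?inE ?eqxx // setUC.
Qed.

Lemma near_regular_bound n : n = #|V| ->
  exists H : {set {set V}}, [/\ H \subset complete3 V, ~~ contains_copy H (star d.+1) &
    (d * d + r) * (n - (2 * d + 1)) <= #|H|].
Proof.
move=> def_n; exists (blowup Q).
have cAB : #|A :|: B| <= 2 * d + 1 by rewrite cardsU nr_cA nr_cB; lia.
split; [exact: blowup_sub nr_Q2|apply: blowup_free nr_Q2 nr_deg _|].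
  (* The graph lives on 2d + 1 vertices, so d bounds every matching. *)
  move=> M sM tM; suff: 2 * #|M| <= #|A :|: B| by move: cAB; card_lia.
  apply: card_trivIset2 tM _ _ => [p /(subsetP sM)/nr_Q2 //|].
  apply: subset_trans nr_cover; apply/bigcupsP => p pM.
  by apply: (bigcup_sup p) => //; apply: (subsetP sM).
rewrite card_blowup // -def_n nr_card leq_mul2l; apply/orP; right.
by apply: leq_sub2l; apply: leq_trans (leq_cards nr_cover) cAB.
Qed.
End NearRegular.

(** The parity in the name is that of k = d + 1. *)
Lemma star_turan_odd n d : ~~ odd d -> 2 * d.+1 <= n ->
  d * d.+1 * (n - 2 * d.+1) <= star_turan n d.+1.
Proof.
move=> ed; case: n => // n hn.
have inj i j : i < n.+1 -> j < n.+1 -> inord i = inord j :> 'I_n.+1 -> i = j.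
  by move=> hi hj /(congr1 val); rewrite /= !inordK.
pose A := [set (inord i : 'I_n.+1) | i : 'I_d.+1].
pose B := [set (inord (d.+1 + i) : 'I_n.+1) | i : 'I_d.+1].
have cA : #|A| = d.+1.
  rewrite card_imset ?card_ord // => i j /inj h; apply/val_inj/h.
    by have := ltn_ord i; lia.
  by have := ltn_ord j; lia.
have cB : #|B| = d.+1.
  rewrite card_imset ?card_ord // => i j /inj h; apply/val_inj.
  have /= := ltn_ord i; have /= := ltn_ord j => hj hi.
  have := h _ _; move=> /(_ ltac:(lia) ltac:(lia)); lia.
have dAB : [disjoint A & B].
  apply/pred0P => x /=; apply/negP => /andP[/imsetP[i _ ->] /imsetP[j _]].
  have := ltn_ord i; have := ltn_ord j => hj hi /inj h.
  have := h ltac:(lia) ltac:(lia); lia.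
have [H [sH fH cH]] := two_cliques_bound cA cB dAB ed (esym (card_ord n.+1)).
exact: leq_trans cH (star_turan_ge sH fH).
Qed.

Lemma star_turan_even n d r : d = 2 * r + 1 -> 2 * d + 1 <= n ->
  (d * d + r) * (n - (2 * d + 1)) <= star_turan n d.+1.
Proof.
move=> def_d; case: n => [|n hn]; first by rewrite addn1.
have inj i j : i < n.+1 -> j < n.+1 -> inord i = inord j :> 'I_n.+1 -> i = j.
  by move=> hi hj /(congr1 val); rewrite /= !inordK.
have [||||H [sH fH cH]] := @near_regular_bound 'I_n.+1 d r (fun i => inord i)
  (fun i => inord (d.+1 + i)) def_d _ _ _ n.+1.
- by move=> i j hi hj /inj; apply; lia.
- by move=> i j hi hj /inj h; have := h ltac:(lia) ltac:(lia); lia.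
- move=> i j hi hj; apply/eqP => /inj h; have := h ltac:(lia) ltac:(lia); lia.
- by rewrite card_ord.
exact: leq_trans cH (star_turan_ge sH fH).
Qed.

Lemma complete_star n k : 2 * k < n -> contains_copy (complete3 'I_n) (star k).
Proof.
move=> hn; have cU : #|{: option ('I_k * bool)}| <= n.
  by rewrite card_option card_prod card_ord card_bool mulnC.
pose f (o : option ('I_k * bool)) := widen_ord cU (enum_rank o).
have injf : injective f by move=> x y /(congr1 val) /= /val_inj/enum_rank_inj.
apply/existsP; exists [ffun o => f o]; apply/andP; split.
  by apply/injectiveP => x y; rewrite !ffunE; apply: injf.
apply/subsetP => _ /imsetP[e eS ->]; have := subsetP (star_sub_complete3 k) e eS.
rewrite !inE card_imset // => x y; rewrite !ffunE; exact: injf.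
Qed.

Lemma star_turan_witness n k : 0 < k ->
  exists H : {set {set 'I_n}}, [/\ H \subset complete3 'I_n,
    ~~ contains_copy H (star k) & #|H| = star_turan n k].
Proof.
move=> k0; pose P := [pred H : {set {set 'I_n}} |
  (H \subset complete3 'I_n) && ~~ contains_copy H (star k)].
have [|H /andP[sH fH] e] := @eq_bigmax_cond _ P (fun H : {set {set 'I_n}} => #|H|).
  apply/card_gt0P; exists set0; rewrite !inE sub0set /=.
  apply/contains_starP => -[x [M [_ cM MH]]]; have /card_gt0P[p pM] : 0 < #|M| by rewrite cM.
  by have := MH p pM; rewrite inE.
by exists H.
Qed.

(** Every t up to f(n,k) + 1 has to be excluded. The first edges of an extremal [H] get distinct
    colors, and all remaining edges share the last one. A rainbow (k+1)-star then has at most one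
    edge outside [H], and its other edges contain a k-star in [H]. *)
Lemma ar_forces_gt n k t : 0 < k -> 2 * k < n -> ar_forces n (star k.+1) t ->
  star_turan n k + 2 <= t.
Proof.
move=> k0 hn /andP[t0 /forallP forces]; rewrite leqNgt; apply/negP => tle.
have [H [sH fH cH]] := star_turan_witness n k0.
case: t t0 forces tle => // t _ forces tle.
pose idx (e : {set 'I_n}) := index e (enum H).
pose c := [ffun e : {set 'I_n} => inord (minn (idx e) t) : 'I_t.+1].
have cval e : val (c e) = minn (idx e) t by rewrite ffunE /= inordK // ltnS geq_minr.
have szH : size (enum H) = star_turan n k by rewrite -cardE cH.
have idxH e : (e \in H) = (idx e < star_turan n k) by rewrite -szH index_mem mem_enum.
have : exact_coloring c.
  apply/eqP/setP => j; rewrite in_setT; apply/imsetP.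
  have [hj|hj] := ltnP j t.
    have hjH : j < size (enum H) by rewrite szH; lia.
    exists (nth set0 (enum H) j).
      by apply: (subsetP sH); rewrite -mem_enum mem_nth.
    apply/val_inj; rewrite cval /idx index_uniq ?enum_uniq //=; lia.
  (* The last color is used by an edge outside [H]; there is one because the complete 3-graph
     contains a k-star. *)
  have [e eC eH] : exists2 e, e \in complete3 'I_n & e \notin H.
    apply/subsetPn; apply: contra fH => sC; have /existsP[f /andP[injf hf]] := complete_star hn.
    by apply/existsP; exists f; rewrite injf (subset_trans hf).
  exists e => //; apply/val_inj; rewrite cval /=; have := ltn_ord j.
  by move: eH; rewrite idxH -leqNgt; lia.
move/(implyP (forces c)) => /rainbow_starP[x [M [sM cM cinj]]].
have [p0 p0M p0P] : exists2 p0, p0 \in M & forall p, p \in M -> p != p0 -> x |: p \in H.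
  have [/existsP[p0 /andP[p0M p0H]]|allH] := boolP [exists p, (p \in M) && (x |: p \notin H)].
    exists p0 => // p pM; apply: contraR => pH; apply/eqP/cinj => //.
    apply/val_inj; rewrite !cval; move: pH p0H; rewrite !idxH -!leqNgt; lia.
  have /card_gt0P[p0 p0M] : 0 < #|M| by rewrite cM.
  exists p0 => // p pM _; apply: contraNT allH => pH.
  by apply/existsP; exists p; rewrite pM.
move/negP: fH; apply; apply/contains_starP; exists x, (M :\ p0); split.
- by apply: smatch_sub sM; apply: subD1set.
- by move: cM; rewrite (cardsD1 p0) p0M => -[].
- by move=> p; rewrite !inE => /andP[np pM]; apply: p0P.
Qed.

(** * Colorings without rainbow stars *)

Lemma ex_subset (T : finType) (A : {set T}) m : m <= #|A| ->
  exists2 B : {set T}, B \subset A & #|B| = m.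
Proof.
elim: m => [|m IHm] hm; first by exists set0; rewrite ?sub0set ?cards0.
have [B sBA cB] := IHm (ltnW hm).
have /subsetPn[x xA xB] : ~~ (A \subset B).
  by apply/negP => /leq_cards; rewrite cB leqNgt hm.
by exists (x |: B); rewrite ?subUset ?sub1set ?xA // cardsU1 xB cB.
Qed.

Lemma card_ltn_ex (T : finType) (A B : {set T}) : #|B| < #|A| -> exists2 x, x \in A & x \notin B.
Proof. by move=> h; apply/subsetPn/negP => /leq_cards; rewrite leqNgt h. Qed.

Lemma cardsU_le (T : finType) (A B : {set T}) : #|A :|: B| <= #|A| + #|B|.
Proof. by rewrite cardsU leq_subr. Qed.

Section Coloring.
Variables (V T : finType) (c : {set V} -> T) (G : {set {set V}}) (d : nat).
Local Notation k := d.+1.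
Implicit Types (x y u v w : V) (M : {set {set V}}) (p q : {set V}) (r : T) (X : {set T}).

Definition rstar x M := smatch x M &&
  [forall p in M, [forall q in M, (c (x |: p) == c (x |: q)) ==> (p == q)]].

Lemma rstarP x M : reflect (smatch x M /\
  forall p q, p \in M -> q \in M -> c (x |: p) = c (x |: q) -> p = q) (rstar x M).
Proof.
apply: (iffP andP) => -[sM inj]; split=> //.
  move=> p q pM qM e; have /forall_inP/(_ p pM)/forall_inP/(_ q qM)/implyP := inj.
  by rewrite e eqxx => /(_ isT)/eqP.
apply/forall_inP => p pM; apply/forall_inP => q qM; apply/implyP => /eqP e.
by rewrite (inj p q).
Qed.

Hypothesis no_rainbow : forall x M, rstar x M -> #|M| <= k.
Hypothesis Ginj : forall e e', e \in G -> e' \in G -> c e = c e' -> e = e'.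
Hypothesis d2 : 2 <= d.

Lemma rstar_smatch x M : rstar x M -> smatch x M.
Proof. by case/andP. Qed.

Lemma card_cover_smatch x M : smatch x M -> #|cover M| = 2 * #|M|.
Proof.
move=> /and3P[/eqP <- /forall_inP h _]; rewrite (eq_bigr (fun=> 2)) => [|p /h/eqP//].
by rewrite sum_nat_const mulnC.
Qed.

Lemma rstar_add x M p : rstar x M -> #|p| = 2 -> x \notin p ->
  [disjoint p & cover M] -> (forall q, q \in M -> c (x |: q) <> c (x |: p)) ->
  rstar x (p |: M) /\ #|p |: M| = #|M|.+1.
Proof.
move=> /rstarP[sM inj] p2 xp dM newc; have /smatchP[h1 h2 h3] := sM.
have pM y q : q \in M -> y \in p -> y \in q -> False.
  move=> qM yp yq; have /pred0P/(_ y) := dM; rewrite /= yp /= => /negP; apply.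
  by apply/bigcupP; exists q.
split; last first.
  rewrite cardsU1 (_ : p \notin M) //; apply/negP => pMM.
  have /card_gt0P[y yp] : 0 < #|p| by rewrite p2.
  exact: (pM y p).
apply/rstarP; split.
  apply/smatchP; split.
  - move=> q q' y /setU1P[->|qM] /setU1P[->|qM'] // yq yq'.
    + by case: (pM y q').
    + by case: (pM y q).
    + exact: (h1 q q' y).
  - by move=> q /setU1P[->//|/h2].
  - by move=> q /setU1P[->//|/h3].
move=> q q' /setU1P[->|qM] /setU1P[->|qM'] // e.
- by case: (newc q' qM').
- by case: (newc q qM).
- exact: inj.
Qed.

(* A star at x with at most k edges none of which has color r extends by an edge
   of color r, whence every rainbow k-star at x uses all robust colors of x. *)
Definition robust x r := [forall B : {set V}, (#|B| <= 2 * k) ==>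
  [exists p : {set V}, [&& #|p| == 2, x \notin p, [disjoint p & B] & c (x |: p) == r]]].

Lemma robustP x r (B : {set V}) : robust x r -> #|B| <= 2 * k ->
  exists p, [/\ #|p| = 2, x \notin p, [disjoint p & B] & c (x |: p) = r].
Proof.
move=> /forallP/(_ B)/implyP h /h /existsP[p /and4P[/eqP ? ? ? /eqP ?]].
by exists p.
Qed.

Lemma robust_ext x r M : robust x r -> rstar x M -> #|M| <= k ->
  (forall p, p \in M -> c (x |: p) <> r) ->
  exists M', [/\ rstar x M', #|M'| = #|M|.+1 &
    forall p, p \in M' -> p \in M \/ c (x |: p) = r].
Proof.
move=> rob sM cM nr; have cc := card_cover_smatch (rstar_smatch sM).
have [|p [p2 xp dp cp]] := robustP rob (B := cover M); first by rewrite cc leq_mul2l cM.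
have [|sM' cM'] := rstar_add sM p2 xp dp; first by move=> q qM; rewrite cp; apply: nr.
exists (p |: M); split=> // q /setU1P[->|]; first by right.
by left.
Qed.

Lemma robust1 x r M : robust x r -> rstar x M ->
  (forall p, p \in M -> c (x |: p) <> r) -> #|M| <= d.
Proof.
move=> rob sM nr; have [M' [sM' cM' _]] := robust_ext rob sM (no_rainbow sM) nr.
by have := no_rainbow sM'; rewrite cM'.
Qed.

Lemma robust2 x r r' M : robust x r -> robust x r' -> r != r' -> rstar x M ->
  (forall p, p \in M -> c (x |: p) <> r /\ c (x |: p) <> r') -> #|M| < d.
Proof.
move=> rob rob' nrr sM nr.
have [M' [sM' cM' hM']] := robust_ext rob sM (no_rainbow sM) (fun p pM => (nr p pM).1).
have /(robust1 rob' sM') : forall p, p \in M' -> c (x |: p) <> r'.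
  move=> p /hM'[/nr[]//|->]; exact/eqP.
by rewrite cM'.
Qed.

(* The pairs that avoid a maximum rainbow star at x only receive its colors, and
   those of them that are not robust are blocked by 2k vertices each. *)
Lemma robust_zone x : 2 * k * k + 2 * k + 3 <= #|V| ->
  exists Z : {set V}, [/\ #|Z| <= 2 * k * k,
    forall y w, y != w -> y != x -> w != x -> y \notin Z -> w \notin Z ->
      robust x (c (x |: [set y; w])),
    #|[set r | robust x r]| <= k & exists r, robust x r].
Proof.
move=> hn.
have [M sM maxM] : exists2 M, rstar x M & forall N, rstar x N -> #|N| <= #|M|.
  have s0 : rstar x set0.
    by apply/rstarP; split=> [|p q]; [apply/smatchP; split=> p|]; rewrite inE.
  by have [M sM maxM] := @arg_maxnP _ set0 (rstar x) (fun N => #|N|) s0; exists M.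
have cM := no_rainbow sM; have cc := card_cover_smatch (rstar_smatch sM).
pose CM := [set c (x |: p) | p in M].
have cCM : #|CM| <= k by apply: leq_trans (leq_imset_card _ _) cM.
have inCM p : #|p| = 2 -> x \notin p -> [disjoint p & cover M] -> c (x |: p) \in CM.
  move=> p2 xp dp; apply/negPn/negP => nc.
  have [|sM' cM'] := rstar_add sM p2 xp dp; last by have := maxM _ sM'; rewrite cM' ltnn.
  by move=> q qM e; move/negP: nc; apply; rewrite -e; apply/imsetP; exists q.
have RCM r : robust x r -> r \in CM.
  move=> rob; apply/negPn/negP => nc.
  have [|M' [sM' cM' _]] := robust_ext rob sM cM; last by have := maxM _ sM'; rewrite cM' ltnn.
  by move=> q qM e; move/negP: nc; apply; rewrite -e; apply/imsetP; exists q.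
have exB r : exists B : {set V}, #|B| <= 2 * k /\ (~~ robust x r ->
    forall p, #|p| = 2 -> x \notin p -> [disjoint p & B] -> c (x |: p) <> r).
  have [rob|] := boolP (robust x r); first by exists set0; rewrite cards0.
  case/forallPn => B; rewrite negb_imply => /andP[cB /existsPn nB]; exists B; split=> // _.
  by move=> p p2 xp dp e; have := nB p; rewrite p2 xp dp e !eqxx.
have {exB}[B hB] := fin_all_exists exB.
pose NR := [set r in CM | ~~ robust x r].
pose Z := cover M :|: \bigcup_(r in NR) B r.
have cZ : #|Z| <= 2 * k + 2 * k * #|NR|.
  apply: leq_trans (cardsU_le _ _) _; apply: leq_add; first by rewrite cc leq_mul2l cM.
  rewrite mulnC -sum_nat_const.
  elim/big_rec2: _ => [|r m S _ IH]; first by rewrite cards0.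
  by apply: leq_trans (cardsU_le _ _) _; apply: leq_add => //; case: (hB r).
have zone y w : y != w -> y != x -> w != x -> y \notin Z -> w \notin Z ->
    robust x (c (x |: [set y; w])).
  move=> nyw nyx nwx yZ wZ; have p2 : #|[set y; w]| = 2 by rewrite cards2 nyw.
  have xp : x \notin [set y; w] by rewrite !inE negb_or ![x == _]eq_sym nyx.
  have dZ (S : {set V}) : S \subset Z -> [disjoint [set y; w] & S].
    move=> SZ; rewrite disjoints_subset subUset !sub1set !inE.
    by rewrite !(contra (subsetP SZ _)).
  have inC := inCM _ p2 xp (dZ _ (subsetUl _ _)).
  apply/negPn/negP => nrob; set r := c _ in inC nrob *.
  have rNR : r \in NR by rewrite inE inC.
  case: (hB r) => _ /(_ nrob _ p2 xp); apply => //; apply: dZ.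
  by apply: subset_trans (subsetUr _ _); apply: (bigcup_sup r).
have NRk : #|NR| <= k by apply: leq_trans cCM; apply: leq_cards; apply/subsetP => r;
  rewrite inE => /andP[].
(* The crude size of [Z], with all k colors of [M] counted as blocked, already leaves two vertices
   outside, and these yield a robust color. *)
have [r rob] : exists r, robust x r.
  have cZ' : #|Z| <= 2 * k + 2 * k * k.
    by apply: leq_trans cZ _; rewrite leq_add2l leq_mul2l NRk orbT.
  have [|y _ yZ] := @card_ltn_ex _ [set: V] (x |: Z).
    by rewrite cardsT; have := cardsU_le [set x] Z; rewrite cards1; move: cZ' hn; card_lia.
  have [|w _ wZ] := @card_ltn_ex _ [set: V] (y |: (x |: Z)).
    rewrite cardsT; have := cardsU_le [set x] Z; have := cardsU_le [set y] (x |: Z).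
    by rewrite !cards1; move: cZ' hn; card_lia.
  move: yZ wZ; rewrite !in_setU1 !negb_or => /andP[yx yZ] /and3P[wy wx wZ].
  by exists (c (x |: [set y; w])); apply: zone => //; rewrite eq_sym.
exists Z; split=> //; last by exists r.
  (* One color of [M] being robust, at most d are blocked, and 2k + 2kd = 2k^2. *)
  apply: leq_trans cZ _; suff : #|NR| < k by move: #|NR| => m hm; nia.
  apply: leq_trans cCM; apply: ltn_cards; rewrite properE; apply/andP; split.
    by apply/subsetP => s; rewrite inE => /andP[].
  by apply/subsetPn; exists r; rewrite ?RCM // inE rob andbF.
apply: leq_trans cCM; apply: leq_cards; apply/subsetP => s; rewrite inE; exact: RCM.
Qed.

(** * Heavy pairs and the links of a rainbow subgraph *)

Definition codeg p := #|[set w | (w \notin p) && (w |: p \in G)]|.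
Definition hv p := (#|p| == 2) && (2 * k <= codeg p).
Definition nb x := [set y | (y != x) && hv [set x; y]].

Lemma light_codeg x y : y != x -> y \notin nb x -> codeg [set x; y] < 2 * k.
Proof. by move=> nyx; rewrite inE nyx /= /hv cards2 [x == y]eq_sym nyx /= -ltnNge. Qed.

(** Of the at least 2k edges of [G] through x and y, each vertex of [F] excludes at most one, and so
    does each color of [X] since [G] has at most one edge per color. The chosen color is new in the
    star: star edges in [G] have other colors by injectivity, the others have colors in [X]. *)
Lemma heavy_step x y M X (F : {set V}) : y \in nb x -> rstar x M ->
  (forall p, p \in M -> x |: p \in G \/ c (x |: p) \in X) ->
  y \notin cover M -> cover M \subset F -> #|F| + #|X| < 2 * k ->
  exists w, [/\ w \notin F, w != y, rstar x ([set y; w] |: M),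
    #|[set y; w] |: M| = #|M|.+1 & x |: [set y; w] \in G /\ c (x |: [set y; w]) \notin X].
Proof.
rewrite inE => /andP[nyx /andP[_ cd]] sM hM yM MF hF.
pose S := [set w | (w \notin [set x; y]) && (w |: [set x; y] \in G)].
pose WX := [set w in S | c (w |: [set x; y]) \in X].
have cWX : #|WX| <= #|X|.
  rewrite -(card_in_imset (_ : {in WX &, injective (fun w => c (w |: [set x; y]))})).
    by apply: leq_cards; apply/subsetP => _ /imsetP[w + ->]; rewrite inE => /andP[].
  move=> w w' /setIdP[wS _] /setIdP[wS' _]; move: wS wS'.
  rewrite inE => /andP[wxy wG]; rewrite inE => /andP[_ wG'].
  move/(Ginj wG wG') => e; have : w \in w' |: [set x; y] by rewrite -e !inE eqxx.
  by rewrite in_setU1 (negPf wxy) orbF => /eqP.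
have [|w wS] := @card_ltn_ex _ S (F :|: WX).
  by apply: leq_ltn_trans (cardsU_le _ _) _; move: cd; rewrite /codeg -/S; move: hF cWX; card_lia.
rewrite inE negb_or => /andP[wF wWX]; move: (wS).
rewrite inE => /andP[wxy wG]; have {wWX} wX : c (w |: [set x; y]) \notin X.
  by apply: contra wWX => wX; apply/setIdP.
have eW : w |: [set x; y] = x |: [set y; w] by rewrite setUCA [w |: _]setUC setUA.
rewrite eW in wG wX; move: wxy; rewrite !inE negb_or => /andP[nwx nwy].
have p2 : #|[set y; w]| = 2 by rewrite cards2 eq_sym nwy.
have xp : x \notin [set y; w] by rewrite !inE negb_or ![x == _]eq_sym nyx.
have [||sM' cM'] := rstar_add sM p2 xp; last by exists w; split.
- rewrite disjoints_subset subUset !sub1set !inE yM.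
  by apply: contra wF; apply: (subsetP MF).
- move=> q qM e; case: (hM q qM) => [qG|]; last by rewrite e (negPf wX).
  have /smatchP[_ _ h3] := rstar_smatch sM.
  have eq := setU1_inj (h3 q qM) xp (Ginj qG wG e).
  by move/negP: yM; apply; apply/bigcupP; exists q; rewrite // eq !inE eqxx.
Qed.

(** Greedy extension: 2|N| + 2|M| + |X| does not change when a heavy neighbour passes from [N] into
    a new star edge, so the same budget serves at every step. *)
Lemma heavy_ext x M (N : {set V}) X : N \subset nb x -> rstar x M ->
  [disjoint N & cover M] ->
  (forall p, p \in M -> x |: p \in G \/ c (x |: p) \in X) ->
  2 * #|N| + 2 * #|M| + #|X| <= 2 * k + 1 ->
  exists M', [/\ rstar x M', M \subset M', #|M'| = #|M| + #|N| &
    forall p, p \in M' -> p \notin M ->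
      [/\ x |: p \in G, c (x |: p) \notin X & exists2 y, y \in N & y \in p]].
Proof.
have [m] := ubnP #|N|; elim: m N M => // m IHm N M ltNm sN sM dN hM hc.
have [N0|/set0Pn[y yN]] := eqVneq N set0.
  by exists M; rewrite N0 cards0 addn0; split=> // p ->.
have cN : #|N| = #|N :\ y|.+1 by rewrite (cardsD1 y) yN.
have yM : y \notin cover M.
  by have /pred0P/(_ y) := dN; rewrite /= yN /= => ->.
(* The heavy neighbours still to be used are forbidden too, lest the new edge consume one of
   them. *)
pose F := cover M :|: (N :\ y).
have [||w [wF nwy sM1 cM1 [wG wX]]] := @heavy_step x y M X F (subsetP sN y yN) sM hM yM.
- exact: subsetUl.
- have := cardsU_le (cover M) (N :\ y); rewrite -/F (card_cover_smatch (rstar_smatch sM)).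
  move: hc cN; card_lia.
have [||||||M' [sM' MM' cM' hM']] := IHm (N :\ y) ([set y; w] |: M).
- by move: ltNm cN; card_lia.
- by apply: subset_trans sN; apply: subD1set.
- exact: sM1.
- apply/pred0P => z /=; apply/negP => /andP[zN /bigcupP[q /setU1P[->|qM] zq]].
    move: zq zN; rewrite !inE => /orP[] /eqP->; rewrite ?eqxx // => h.
    by move/negP: wF; apply; rewrite !inE h orbT.
  have /pred0P/(_ z) := dN; rewrite /= (subsetP (subD1set N y) z zN) /=.
  by move/negP; apply; apply/bigcupP; exists q.
- by move=> p /setU1P[->|/hM//]; left.
- by rewrite cM1; move: hc cN; card_lia.
exists M'; split=> //.
- by apply: subset_trans MM'; apply: subsetUr.
- by rewrite cM' cM1 cN addnS addSn.
move=> p pM' pM; have [pe|npe] := eqVneq p [set y; w].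
  by rewrite pe; split=> //; exists y; rewrite // !inE eqxx.
have [|h1 h2 [z zN zp]] := hM' p pM'; first by rewrite !inE (negPf npe).
by split=> //; exists z => //; apply: (subsetP (subD1set N y)).
Qed.

(** The heavy neighbours of u are kept free because each can carry a star edge of its own; the
    colors of [X] are kept free for robust ones. *)
Definition linkE u X := [set p : {set V} |
  [&& #|p| == 2, u \notin p, [disjoint p & nb u], u |: p \in G & c (u |: p) \notin X]].

Lemma linkE_rstar u X M U : matching (linkE u X) M U -> rstar u M.
Proof.
move=> mM; have /and3P[sM tM _] := mM.
have inE' p : p \in M -> [/\ #|p| = 2, u \notin p & u |: p \in G].
  by move/(subsetP sM); rewrite inE => /and5P[/eqP].
apply/rstarP; split.
  apply/smatchP; split=> [p q y pM qM yp yq|p /inE'[]//|p /inE'[]//].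
  exact: (matching_disj mM pM qM yp yq).
move=> p q /inE'[_ up pG] /inE'[_ uq qG] /(Ginj pG qG).
exact: setU1_inj.
Qed.

Lemma linkE_color u X p : p \in linkE u X -> u |: p \in G /\ c (u |: p) \notin X.
Proof. by rewrite inE => /and5P[]. Qed.

(** Heavy neighbours and matching edges combine to one star. Both later uses, m = k with one
    reserved color and m = d with two, fit the budget of [heavy_ext]. *)
Lemma linkE_star u X X' m : X' \subset X -> 2 * m + #|X'| <= 2 * k + 1 ->
  m <= nu (linkE u X) setT + #|nb u| ->
  exists M, [/\ rstar u M, #|M| = m & forall p, p \in M -> c (u |: p) \notin X'].
Proof.
move=> sX hm hle; have [M mM cM] := nu_ex (linkE u X) setT; rewrite -cM in hle.
have [N sN cN] := @ex_subset _ (nb u) (minn m #|nb u|) (geq_minr _ _).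
have [|M0 sM0 cM0] := @ex_subset _ M (m - #|N|).
  by rewrite cN; move: hle; card_lia.
have mM0 := matching_subset sM0 mM; have /and3P[sE _ _] := mM0.
have cNm : #|N| <= m by rewrite cN geq_minl.
have [|||M' [sM' MM' cM' hM']] := @heavy_ext u M0 N X' sN (linkE_rstar mM0).
- apply/pred0P => z /=; apply/negP => /andP[/(subsetP sN) zn /bigcupP[p pM zp]].
  have := subsetP sE p pM; rewrite inE => /and5P[_ _ /pred0P/(_ z)].
  by rewrite /= zp zn.
- by move=> p /(subsetP sE)/linkE_color[]; left.
- by rewrite cM0; move: hm cNm; card_lia.
exists M'; split=> //; first by rewrite cM' cM0 subnK.
move=> p pM'; have [pM|pM] := boolP (p \in M0); last by case: (hM' p pM' pM).
by apply: contra (linkE_color (subsetP sE p pM)).2; apply: (subsetP sX).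
Qed.

Lemma nu_linkE1 u X r : robust u r -> r \in X -> nu (linkE u X) setT + #|nb u| <= d.
Proof.
move=> rob rX; rewrite leqNgt; apply/negP => h.
have [||M [sM cM hM]] := @linkE_star u X [set r] k _ _ h; rewrite ?sub1set ?cards1 //.
have := robust1 rob sM; rewrite cM ltnn => /(_ _)/negP[] // p /hM.
by rewrite inE => /eqP.
Qed.

Lemma nu_linkE2 u X r r' : robust u r -> robust u r' -> r != r' -> r \in X -> r' \in X ->
  nu (linkE u X) setT + #|nb u| < d.
Proof.
move=> rob rob' nrr rX rX'; rewrite ltnNge; apply/negP => h.
have [||M [sM cM hM]] := @linkE_star u X [set r; r'] d _ _ h.
- by rewrite subUset !sub1set rX.
- by rewrite cards2 nrr; lia.
have := robust2 rob rob' nrr sM; rewrite cM ltnn => /(_ _)/negP[] // p /hM.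
by rewrite !inE negb_or => /andP[/eqP ? /eqP].
Qed.

(* The star through the d heavy neighbours is built avoiding both r and the color of
   x |: p; the choice of y0 makes the threshold 2k of heaviness just sufficient. *)
Lemma full_color x r p : #|nb x| = d -> robust x r -> #|p| = 2 -> x \notin p ->
  [disjoint p & nb x] -> c (x |: p) = r.
Proof.
move=> cn rob p2 xp dp; apply/eqP/negPn/negP => /eqP ncr.
have s1 : rstar x [set p].
  apply/rstarP; split=> [|q q' /set1P-> /set1P->//]; apply/smatchP; split.
  - by move=> q q' y /set1P-> /set1P->.
  - by move=> q /set1P->.
  - by move=> q /set1P->.
have cov1 : cover [set p] = p by rewrite /cover big_set1.
(* If the only edge of [G] of color r meets [nb x], then y0 is taken on it. Once y0 is covered, no
   later edge through a heavy neighbour can have color r, so only the first step must avoid r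
   explicitly. *)
have [y0 y0n y0P] : exists2 y0, y0 \in nb x & forall e y, e \in G -> c e = r ->
    y \in e -> y \in nb x -> y0 \in e.
  have [/existsP[e /and4P[eG /eqP er]]|none] :=
      boolP [exists e, [&& e \in G, c e == r, ~~ [disjoint e & nb x] & true]].
    case/pred0Pn => y0 /= /andP[y0e y0n] _; exists y0 => // e' y e'G e'r _ _.
    by rewrite (Ginj e'G eG) // er.
  have /card_gt0P[y0 y0n] : 0 < #|nb x| by rewrite cn; lia.
  exists y0 => // e y eG er ye yn; move/existsPn: none => /(_ e).
  rewrite eG er eqxx andbT /= negbK => /pred0P/(_ y).
  by rewrite /= ye yn.
pose F := p :|: (nb x :\ y0).
have cnD : #|nb x| = #|nb x :\ y0|.+1 by rewrite (cardsD1 y0) y0n.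
have y0p : y0 \notin p by apply/negP => h; have /pred0P/(_ y0) := dp; rewrite /= h y0n.
have [|||| w0 [w0F nw0 s2 c2 [w0G w0X]]] :=
  @heavy_step x y0 [set p] [set c (x |: p); r] F y0n s1; rewrite ?cov1 //.
- by move=> q /set1P->; right; rewrite !inE eqxx.
- exact: subsetUl.
- rewrite cards2; have := cardsU_le p (nb x :\ y0); rewrite -/F p2.
  by case: (c _ != r) => /=; move: cn cnD d2; card_lia.
have [|||M [sM MM cM hM]] := @heavy_ext x ([set y0; w0] |: [set p]) (nb x :\ y0) [set c (x |: p)]
    (subD1set _ _) s2.
- apply/pred0P => z /=; apply/negP => /andP[zn /bigcupP[q /setU1P[->|/set1P->] zq]].
    move: zq zn; rewrite !inE => /orP[] /eqP->; rewrite ?eqxx // => h.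
    by move/negP: w0F; apply; rewrite !inE h orbT.
  by have /pred0P/(_ z) := dp; rewrite /= zq (subsetP (subD1set _ _) z zn).
- move=> q /setU1P[->|/set1P->]; first by left.
  by right; rewrite inE.
- by rewrite c2 !cards1; move: cn cnD; card_lia.
suff : #|M| <= d by rewrite cM c2 cards1; move: cn cnD; card_lia.
apply: (robust1 rob sM) => q qM.
have [/setU1P[->|/set1P->]//|qn] := boolP (q \in [set y0; w0] |: [set p]).
  by move: w0X; rewrite !inE negb_or => /andP[_ /eqP].
  have [qG _ [y yn yq]] := hM q qM qn; move=> e.
  have := y0P _ y qG e (setU1r _ yq) (subsetP (subD1set _ _) y yn).
  rewrite in_setU1 => /orP[/eqP y0x|y0q]; first by move: y0n; rewrite inE y0x eqxx.
  have /smatchP[h1 _ _] := rstar_smatch sM.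
  have : q = [set y0; w0].
    apply: (h1 _ _ y0 qM _ y0q); last by rewrite !inE eqxx.
    by apply: (subsetP MM); rewrite !inE eqxx.
by move=> eq; rewrite eq !inE eqxx in qn.
Qed.
End Coloring.

(** * Weights *)

Section Weights.
Variables (V T : finType) (c : {set V} -> T) (G : {set {set V}}) (d : nat).
Local Notation hv := (hv G d).
Local Notation nb := (nb G d).
Local Notation linkE := (linkE c G d).
Implicit Types (x y u v w : V) (M : {set {set V}}) (p q e : {set V}) (X : {set T}).
Hypothesis G3 : forall e, e \in G -> #|e| = 3.
Hypothesis nb_le : forall u, #|nb u| <= d.
Hypothesis d2 : 2 <= d.

(** The cutoff 2d/3 is tight on both sides: [wdeg_lo] needs vertices that are not [hi] to stay below
    it, and [wsum_pos] needs [hi] vertices to reach it. *)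
Definition hi y := 3 * (d - #|nb y|) <= d.
Definition lo y := 2 * #|nb y| < d.

(* An edge of G gives (in twelfths) its weight to the vertices opposite to its heavy
   pairs; an edge without heavy pairs gives it to its vertices of large heavy degree. *)
Definition wt u e :=
  if hv (e :\ u) then (if [disjoint e & nb u] then 12 else 6)
  else if ~~ [disjoint e & nb u] then 0
  else if hi u then 12 else if [exists y in e, hi y] then 0
  else if ~~ lo u then 6 else if [exists y in e, ~~ lo y] then 3 else 4.

Lemma nbC x y : (y \in nb x) = (x \in nb y).
Proof. by rewrite !inE eq_sym setUC. Qed.

Lemma nb_irr x : x \notin nb x.
Proof. by rewrite inE eqxx. Qed.

Lemma mem_nb x y : x != y -> (y \in nb x) = hv [set x; y].
Proof. by move=> nxy; rewrite inE eq_sym nxy. Qed.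

Lemma lo_hi y : lo y -> ~~ hi y.
Proof. by rewrite /lo /hi; move: #|nb y| => a; lia. Qed.

Lemma disjoint3 (A : {set V}) x y z :
  [disjoint [set x; y; z] & A] = [&& x \notin A, y \notin A & z \notin A].
Proof. by rewrite disjoints_subset !subUset !sub1set !inE andbA. Qed.

Lemma exists3 (P : pred V) x y z :
  [exists t in [set x; y; z], P t] = [|| P x, P y | P z].
Proof.
apply/exists_inP/or3P => [[t]|[] h].
- by rewrite !inE => /orP[/orP[]|] /eqP-> h; [apply: Or31|apply: Or32|apply: Or33].
- by exists x; rewrite // !inE eqxx.
- by exists y; rewrite // !inE eqxx orbT.
- by exists z; rewrite // !inE eqxx orbT.
Qed.

(** One heavy pair gives 12 to the opposite vertex; with two or three, each opposite vertex gets 6.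
    Without heavy pairs, a [hi] vertex gets 12; failing that, one vertex that is not [lo] makes 6 +
    3 + 3, and three [lo] vertices make 4 + 4 + 4. *)
Lemma wt_sum e : #|e| = 3 -> 12 <= \sum_(u in e) wt u e.
Proof.
move=> e3; have /card_gt0P[x xe] : 0 < #|e| by rewrite e3.
have := e3; rewrite (cardsD1 x) xe => -[] /eqP/cards2P[y [z [nyz exy]]].
have : y \in e :\ x by rewrite exy !inE eqxx.
rewrite !inE => /andP[nyx ye]; have : z \in e :\ x by rewrite exy !inE eqxx orbT.
rewrite !inE => /andP[nzx ze].
have def_e : e = [set x; y; z] by rewrite -(setD1K xe) exy setUA.
have eE t t1 t2 : e = [set t; t1; t2] -> t != t1 -> t != t2 -> t1 != t2 ->
    wt t e = if hv [set t1; t2] then (if hv [set t; t1] || hv [set t; t2] then 6 else 12)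
      else if hv [set t; t1] || hv [set t; t2] then 0
      else if hi t then 12 else if [|| hi x, hi y | hi z] then 0
      else if ~~ lo t then 6 else if [|| ~~ lo x, ~~ lo y | ~~ lo z] then 3 else 4.
  move=> de n1 n2 n12; rewrite /wt.
  have -> : [exists s in e, hi s] = [|| hi x, hi y | hi z] by rewrite def_e (exists3 hi).
  have -> : [exists s in e, ~~ lo s] = [|| ~~ lo x, ~~ lo y | ~~ lo z].
    by rewrite def_e (exists3 (fun s => ~~ lo s)).
  have -> : e :\ t = [set t1; t2].
    by rewrite de -setUA setU1K // !inE negb_or n1.
  have -> : [disjoint e & nb t] = ~~ (hv [set t; t1] || hv [set t; t2]).
    by rewrite de disjoint3 nb_irr !mem_nb //= negb_or.
  by case: (hv _) => //; case: (_ || _).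
have sumE : \sum_(u in e) wt u e = wt x e + (wt y e + wt z e).
  rewrite (bigD1 x) //= (bigD1 y) /= ?ye ?nyx // (bigD1 z) /=; last by rewrite ze nzx eq_sym nyz.
  rewrite big1 ?addn0 // => t /andP[/andP[/andP[te ntx] nty] ntz].
  by move: te; rewrite def_e !inE (negPf ntx) (negPf nty) (negPf ntz).
have nxy : x != y by rewrite eq_sym.
have nxz : x != z by rewrite eq_sym.
have nzy : z != y by rewrite eq_sym.
have ey : e = [set y; x; z] by rewrite def_e [[set y; x]]setUC.
have ez : e = [set z; x; y] by rewrite def_e setUC setUA.
rewrite sumE (eE x y z) // (eE y x z) // (eE z x y) //.
rewrite [[set y; x]]setUC [[set z; x]]setUC [[set z; y]]setUC.
case: (hv [set x; y]); case: (hv [set x; z]); case: (hv [set y; z]) => //=.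
case: (hi x); case: (hi y); case: (hi z) => //=.
by case: (lo x); case: (lo y); case: (lo z).
Qed.

Definition wsum u X := \sum_(e in G | (u \in e) && (c e \notin X)) wt u e.
Definition Wp u p := wt u (u |: p).

Lemma linkE_card2 u X p : p \in linkE u X -> #|p| = 2.
Proof. by rewrite inE => /andP[/eqP]. Qed.

(** An edge at u meeting [nb u] counts only if its opposite pair is heavy, and then it counts 6. It
    is reached by going from u to a heavy neighbour y and from y to a heavy neighbour other than u,
    in at most |nb u|(d - 1) ways. *)
Lemma wsum_le u X :
  wsum u X <= 6 * (#|nb u| * d.-1) + win (linkE u X) (Wp u) setT.
Proof.
rewrite /wsum (bigID (fun e : {set V} => [disjoint e & nb u])) /= addnC; apply: leq_add.
  pose S := \bigcup_(y in nb u) [set u |: [set y; z] | z in nb y :\ u].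
  apply: leq_trans (_ : 6 * #|S| <= _).
    rewrite -sum1_card big_distrr /= [X in _ <= X]big_mkcond [X in X <= _]big_mkcond.
    apply: leq_sum => e _; case: ifP => // /andP[/andP[eG /andP[ue _]] nd].
    rewrite /wt (negPf nd) /=; case: ifP => // he.
    have {nd}/pred0Pn[y /andP[/= ye yn]] := nd.
    have nyu : y != u by apply: contraTneq yn => ->; apply: nb_irr.
    have := G3 eG; rewrite (cardsD1 u) ue => -[]; rewrite (cardsD1 y) !inE nyu ye => -[].
    move/eqP/cards1P => [z ez]; have : z \in e :\ u :\ y by rewrite ez !inE eqxx.
    rewrite !inE => /and3P[nzy nzu ze].
    have euyz : e :\ u = [set y; z] by rewrite -(@setD1K _ y (e :\ u)) ?ez // !inE nyu.
    rewrite (_ : e \in S) //; apply/bigcupP; exists y => //; apply/imsetP; exists z.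
      by rewrite !inE nzu nzy -euyz.
    by rewrite -euyz setD1K.
  rewrite leq_mul2l /=; apply: leq_trans (_ : \sum_(y in nb u) d.-1 <= _);
    last by rewrite sum_nat_const.
  apply: leq_trans (_ : \sum_(y in nb u) #|[set u |: [set y; z] | z in nb y :\ u]| <= _).
    rewrite /S; elim/big_rec2: _ => [|y m S' _ IH]; first by rewrite cards0.
    by apply: leq_trans (cardsU_le _ _) _; apply: leq_add.
  apply: leq_sum => y yn; apply: leq_trans (leq_imset_card _ _) _.
  by have := nb_le y; rewrite (cardsD1 u) -nbC yn; case: (d).
rewrite /win; under [X in _ <= X]eq_bigl => p do rewrite subsetT andbT.
have inj : {in linkE u X &, injective (fun p => u |: p)}.
  move=> p q; rewrite !inE => /and5P[_ up _ _ _] /and5P[_ uq _ _ _].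
  exact: setU1_inj.
rewrite /Wp -(big_imset (wt u) inj) /= [X in _ <= X]big_mkcond [X in X <= _]big_mkcond.
apply: leq_sum => e _; case: ifP => // /andP[/andP[eG /andP[ue eX]] de].
rewrite (_ : e \in _) //; apply/imsetP; exists (e :\ u); last by rewrite setD1K.
have := G3 eG; rewrite (cardsD1 u) ue add1n => -[] e2; rewrite inE; apply/and5P; split.
- by rewrite e2.
- by rewrite !inE eqxx.
- exact: disjointWl (subD1set e u) de.
- by rewrite setD1K.
- by rewrite setD1K.
Qed.

(** The bound (12 - s)H + sN, with H heavy pairs among N pairs at y, written without subtraction. *)
Lemma star_weight u X y s (S : pred {set V}) :
  (forall p, p \in linkE u X -> y \in p -> ~~ hv p -> Wp u p <= s) ->
  \sum_(p in linkE u X | (y \in p) && S p) Wp u p +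
    s * (\sum_(p in linkE u X | (y \in p) && S p) (hv p : nat)) <=
  12 * (\sum_(p in linkE u X | (y \in p) && S p) (hv p : nat)) +
    s * #|[set p in linkE u X | (y \in p) && S p]|.
Proof.
move=> hs; rewrite -sum1dep_card !big_distrr -!big_split /=.
apply: leq_sum => p /and3P[pE yp _]; case: (boolP (hv p)) => [hp|hp] /=.
  by rewrite !muln1 leq_add2r /Wp /wt; do 6?case: ifP.
by rewrite !muln0 muln1 addn0 hs.
Qed.

Lemma heavy_at_le u X y (N : {set V}) (S : pred {set V}) :
  (forall z, y != z -> [set y; z] \in linkE u X -> S [set y; z] -> z \in nb y -> z \in N) ->
  \sum_(p in linkE u X | (y \in p) && S p) (hv p : nat) <= #|N|.
Proof.
move=> hN; rewrite (eq_bigr (fun p : {set V} => if hv p then 1 else 0)); last by move=> p _;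
  case: (hv p).
rewrite -big_mkcondr /= sum1dep_card.
apply: leq_trans (_ : #|[set q in [set p in linkE u X | S p && hv p] | y \in q]| <= _).
  apply: leq_cards; apply/subsetP => p; rewrite inE => /andP[/and3P[pE yp Sp] hp].
  by apply/setIdP; split=> //; apply/setIdP; rewrite Sp hp.
apply: star_set_le => q /setIdP[qE /andP[Sq hq]] yq.
have [z zq def_q] : exists2 z, z \in q :\ y & q = [set y; z].
  have [|z] := @pairs_other _ q q y _ yq; last by exists z.
  by rewrite inE subxx (linkE_card2 qE).
move: zq; rewrite !inE eq_sym => /andP[nyz _].
by exists z => //; apply: hN; rewrite -?def_q // mem_nb // -def_q.
Qed.

Lemma count_at_le u X y (N : {set V}) (S : pred {set V}) :
  (forall z, y != z -> [set y; z] \in linkE u X -> S [set y; z] -> z \in N) ->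
  #|[set p in linkE u X | (y \in p) && S p]| <= #|N|.
Proof.
move=> hN.
apply: leq_trans (_ : #|[set q in [set p in linkE u X | S p] | y \in q]| <= _).
  apply: leq_cards; apply/subsetP => p /setIdP[pE /andP[yp Sp]].
  by apply/setIdP; split=> //; apply/setIdP.
apply: star_set_le => q /setIdP[qE Sq] yq.
have [z zq def_q] : exists2 z, z \in q :\ y & q = [set y; z].
  have [|z] := @pairs_other _ q q y _ yq; last by exists z.
  by rewrite inE subxx (linkE_card2 qE).
move: zq; rewrite !inE eq_sym => /andP[nyz _].
by exists z => //; apply: hN; rewrite -?def_q.
Qed.

Lemma light_weight u X y p : p \in linkE u X -> y \in p -> ~~ hv p ->
  Wp u p = if hi u then 12 else if [exists z in u |: p, hi z] then 0
    else if ~~ lo u then 6 else if [exists z in u |: p, ~~ lo z] then 3 else 4.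
Proof.
rewrite inE => /and5P[_ up dp _ _] yp hp; rewrite /Wp /wt setU1K // (negPf hp).
rewrite (_ : [disjoint u |: p & nb u]) // disjoints_subset subUset sub1set inE nb_irr /=.
by rewrite -disjoints_subset.
Qed.

Lemma Wp_le12 u p : Wp u p <= 12.
Proof. by rewrite /Wp /wt; do 6?case: ifP. Qed.

(** No pair of [linkE] contains a heavy neighbour of u; for any other y the pair uy is light and
    lies in at most 2k - 1 edges. *)
Lemma link_codeg u X y : #|[set p in linkE u X | (y \in p) && true]| <= 2 * d + 1.
Proof.
have [yn|yn] := boolP (y \in nb u).
  rewrite (_ : [set _ in _ | _] = set0) ?cards0 //; apply/setP => p; rewrite !inE.
  apply/negP => /andP[/and5P[_ _ dp _ _] /andP[yp _]].
  by have /pred0P/(_ y) := dp; rewrite /= yp yn.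
have [->|nyu] := eqVneq y u.
  rewrite (_ : [set _ in _ | _] = set0) ?cards0 //; apply/setP => p; rewrite !inE.
  by apply/negP => /andP[/and5P[_ up _ _ _] /andP[yp _]]; rewrite yp in up.
apply: leq_trans (_ : codeg G [set u; y] <= _); last first.
  by have := light_codeg nyu yn; lia.
rewrite /codeg; apply: count_at_le => z nyz; rewrite inE => /and5P[_ + _ zG _] _.
rewrite !inE !negb_or => /andP[_ nuz]; rewrite ![z == _]eq_sym nuz nyz /=.
by rewrite (_ : z |: [set u; y] = u |: [set y; z]) // setUCA [z |: _]setUC.
Qed.

Lemma light_hi u X y p : ~~ hi u -> hi y -> p \in linkE u X -> y \in p -> ~~ hv p -> Wp u p <= 0.
Proof.
move=> hu hy pE yp hp; rewrite (light_weight pE yp hp) (negPf hu).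
by rewrite (_ : [exists z in _, _]) //; apply/exists_inP; exists y; rewrite // !inE yp orbT.
Qed.

Lemma light_mid u X y p : lo u -> ~~ lo y -> p \in linkE u X -> y \in p -> ~~ hv p -> Wp u p <= 3.
Proof.
move=> lu ly pE yp hp; rewrite (light_weight pE yp hp) (negPf (lo_hi lu)) lu.
case: ifP => //= _; rewrite (_ : [exists z in _, ~~ lo z]) //.
by apply/exists_inP; exists y; rewrite // !inE yp orbT.
Qed.

Lemma light_lo u X y p : lo u -> p \in linkE u X -> y \in p -> ~~ hv p -> Wp u p <= 4.
Proof.
move=> lu pE yp hp; rewrite (light_weight pE yp hp) (negPf (lo_hi lu)) lu /=.
by do 2?case: ifP.
Qed.

Lemma light_nothi u X y p : ~~ hi u -> p \in linkE u X -> y \in p -> ~~ hv p -> Wp u p <= 6.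
Proof.
by move=> hu pE yp hp; rewrite (light_weight pE yp hp) (negPf hu); do 3?case: ifP.
Qed.

Lemma wdegT u X y : wdeg (linkE u X) (Wp u) y =
  \sum_(p in linkE u X | (y \in p) && true) Wp u p.
Proof. by apply: eq_bigl => p; rewrite andbT. Qed.

(** With a = |nb y|, the cases y [hi], [lo] or neither give 12a, 8a + 4(2d + 1) and 9a + 3(2d + 1).
    For the last two, 2a <= d - 1 and 3a <= 2d - 1 are exactly what is needed. *)
Lemma wdeg_lo u X y : lo u -> wdeg (linkE u X) (Wp u) y <= 12 * d.
Proof.
move=> lu; rewrite wdegT.
have hH : \sum_(p in linkE u X | (y \in p) && true) (hv p : nat) <= #|nb y|.
  by apply: heavy_at_le.
have hN := link_codeg u X y; have ha := nb_le y.
have := @star_weight u X y _ xpredT.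
move: (\sum_(p in _ | _) Wp u p) (\sum_(p in _ | _) _) #|[set _ in _ | _]| hH hN => S H N hH hN sw.
have [hy|hy] := boolP (hi y).
  have := sw 0 (fun p => light_hi (lo_hi lu) hy); move: hH ha; move: #|nb y| => a; lia.
have [ly|ly] := boolP (lo y).
  by have := sw 4 (fun p => light_lo lu); move: ly; rewrite /lo; move: hH ha;
    move: #|nb y| => a; lia.
by have := sw 3 (fun p => light_mid lu ly); move: hy; rewrite /hi; move: hH ha;
  move: #|nb y| => a; lia.
Qed.

Lemma wdeg_mid u X y : ~~ hi u -> wdeg (linkE u X) (Wp u) y <= 16 * d + 4.
Proof.
move=> hu; rewrite wdegT.
have hH : \sum_(p in linkE u X | (y \in p) && true) (hv p : nat) <= #|nb y|.
  by apply: heavy_at_le.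
have hN := link_codeg u X y; have ha := nb_le y.
have := @star_weight u X y _ xpredT.
move: (\sum_(p in _ | _) Wp u p) (\sum_(p in _ | _) _) #|[set _ in _ | _]| hH hN => S H N hH hN sw.
have [hy|hy] := boolP (hi y).
  have := sw 0 (fun p => light_hi hu hy); move: hH ha; move: #|nb y| => a; lia.
by have := sw 6 (fun p => light_nothi hu); move: hy; rewrite /hi; move: hH ha;
  move: #|nb y| => a; lia.
Qed.

Lemma wdeg_all u X y : wdeg (linkE u X) (Wp u) y <= 12 * (2 * d + 1).
Proof.
rewrite wdegT; apply: leq_trans (_ : \sum_(p in linkE u X | (y \in p) && true) 12 <= _).
  by apply: leq_sum => p _; apply: Wp_le12.
by rewrite sum_nat_cond_const -/(_ && _) mulnC leq_mul2l /= link_codeg.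
Qed.

Definition hdeg_in u X (K : {set V}) y :=
  wdeg_in (linkE u X) (fun p => hv p : nat) K y.

(** Inside [K] at most 2d - 2 pairs at y remain instead of 2d + 1; three shares of 3 or 4 are saved.
    If y is [hi], the saving comes from a missing heavy pair. *)
Lemma wdeg_in_slack u X (K : {set V}) y : lo u -> y \in K -> #|K| <= 2 * d - 1 ->
  hdeg_in u X K y < d -> wdeg_in (linkE u X) (Wp u) K y + 9 <= 12 * d.
Proof.
move=> lu yK cK; rewrite /hdeg_in /wdeg_in => hd.
have hH : \sum_(p in linkE u X | (y \in p) && (p \subset K)) (hv p : nat) <= #|nb y|.
  by apply: heavy_at_le.
have hN : #|[set p in linkE u X | (y \in p) && (p \subset K)]| <= 2 * d - 2.
  apply: leq_trans (_ : #|K :\ y| <= _); last by move: cK; rewrite (cardsD1 y) yK; card_lia.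
  apply: (@count_at_le u X y (K :\ y) (fun p => p \subset K)) => z nyz _ /subsetP h.
  by rewrite !inE eq_sym nyz h // !inE eqxx orbT.
have ha := nb_le y.
have := @star_weight u X y _ (fun p => p \subset K).
move: (\sum_(p in _ | _) Wp u p) (\sum_(p in _ | _) _) #|[set _ in _ | _]| hH hN hd
  => S H N hH hN hd sw.
have [hy|hy] := boolP (hi y).
  have := sw 0 (fun p => light_hi (lo_hi lu) hy); move: hH ha; move: #|nb y| => a; lia.
have [ly|ly] := boolP (lo y).
  by have := sw 4 (fun p => light_lo lu); move: ly; rewrite /lo; move: hH ha;
    move: #|nb y| => a; lia.
by have := sw 3 (fun p => light_mid lu ly); move: hy; rewrite /hi; move: hH ha;
  move: #|nb y| => a; lia.
Qed.

Lemma win_slack u X (K Y : {set V}) : lo u -> Y \subset K -> #|K| <= 2 * d - 1 ->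
  (forall y, y \in Y -> hdeg_in u X K y < d) ->
  2 * win (linkE u X) (Wp u) K + 9 * #|Y| <= 12 * d * #|K|.
Proof.
move=> lu YK cK hY; rewrite (handshake _ (@linkE_card2 u X)).
have -> : #|Y| = \sum_(y in K) (y \in Y : nat).
  rewrite (eq_bigr (fun y => if y \in Y then 1 else 0)); last by move=> y _; case: (y \in Y).
  rewrite -big_mkcondr sum1dep_card; apply: eq_card => y; rewrite inE.
  by have [yY|] := boolP (y \in Y); rewrite ?andbF // (subsetP YK).
rewrite big_distrr -big_split [12 * d * _]mulnC -sum_nat_const /=; apply: leq_sum => y yK.
have [yY|yY] := boolP (y \in Y); first by rewrite muln1; apply: wdeg_in_slack (hY y yY).
by rewrite muln0 addn0; apply: leq_trans (wdeg_in_le _ _ _ _) (wdeg_lo _ _ lu).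
Qed.

(* For odd d, light edges inside an odd component K force two vertices of positive
   slack, and otherwise the heavy degrees in K cannot all be equal to d. *)
Lemma win_parity u X (K : {set V}) : odd d -> lo u -> odd #|K| -> #|K| <= 2 * d - 1 ->
  2 * win (linkE u X) (Wp u) K + 12 <= 12 * d * #|K|.
Proof.
move=> od lu oK cK; pose Y := [set y in K | hdeg_in u X K y < d].
have YK : Y \subset K by apply/subsetP => y /setIdP[].
have [Y1|Y1] := leqP #|Y| 1; last first.
  have := win_slack lu YK cK (fun y yY => proj2 (setIdP yY)).
  by move: Y1; move: (win _ _ _) #|Y| (12 * d * _) => *; lia.
have W0 p : p \in linkE u X -> p \subset K -> Wp u p <= 12 * hv p.
  move=> pE pK; have [hp|hp] := boolP (hv p); first exact: Wp_le12.
  have [y yp yY] : exists2 y, y \in p & y \notin Y.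
    apply/subsetPn/negP => /leq_cards; rewrite (linkE_card2 pE); move: Y1; card_lia.
  rewrite muln0; apply: (light_hi (lo_hi lu) _ pE yp hp).
  have : d <= hdeg_in u X K y.
    by rewrite leqNgt; apply: contra yY => h; apply/setIdP; rewrite (subsetP pK).
  move=> h; have {h} : d <= #|nb y| by apply: leq_trans h _; apply: heavy_at_le.
  by rewrite /hi; move: #|nb y| => a; lia.
have wH : win (linkE u X) (Wp u) K <= 12 * win (linkE u X) (fun p => hv p : nat) K.
  by rewrite /win big_distrr /=; apply: leq_sum => p /andP[pE pK]; apply: W0.
have : 2 * win (linkE u X) (fun p => hv p : nat) K <= d * #|K|.
  rewrite (handshake _ (@linkE_card2 u X)) [d * _]mulnC -sum_nat_const; apply: leq_sum => y _.
  by apply: leq_trans (nb_le y); apply: heavy_at_le.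
(* Twice the number of heavy pairs in [K] is even and d|K| is odd; the unit lost is worth 12. *)
have : odd (d * #|K|) by rewrite oddM od.
move: wH; rewrite -mulnA; move: (d * _) (win _ _ _) (win _ _ _) => D w h; lia.
Qed.
End Weights.

(** * The weight received by one vertex *)

Section VertexBounds.
Variables (V T : finType) (c : {set V} -> T) (G : {set {set V}}) (d : nat).
Local Notation nb := (nb G d).
Local Notation linkE := (linkE c G d).
Local Notation hi := (hi G d).
Local Notation lo := (lo G d).
Local Notation Wp := (Wp G d).
Local Notation wsum := (wsum c G d).
Implicit Types (x y u v w : V) (M : {set {set V}}) (p q e : {set V}) (X : {set T}).
Hypothesis G3 : forall e, e \in G -> #|e| = 3.
Hypothesis nb_le : forall u, #|nb u| <= d.
Hypothesis d2 : 2 <= d.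

Lemma loE u : lo u = (2 * #|nb u| < d).
Proof. by []. Qed.

Lemma hiE u : hi u = (3 * (d - #|nb u|) <= d).
Proof. by []. Qed.

(** A heavy neighbour takes away a matching edge, worth 12d, and returns only 6(d - 1) by [wsum_le].
    For [lo] u the gain absorbs the excess 6d of the at most one large odd block. Otherwise link
    degrees are larger, but the matching number b is small: 3b <= m for [hi] u, which is just
    enough, and 2b <= m in the middle range. *)
Lemma wsum_pos u X m : 0 < #|nb u| -> nu (linkE u X) setT + #|nb u| <= m -> m <= d ->
  wsum u X <= 12 * d * m.
Proof.
move=> a0 hnu md; apply: leq_trans (wsum_le c G3 nb_le u X) _.
have W12 p : p \in linkE u X -> Wp u p <= 12 by move=> _; apply: Wp_le12.
have E2 := @linkE_card2 _ _ c G d u X; have ha := nb_le u.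
have [lu|lu] := boolP (lo u).
  have [t ht hw] := degree_bound E2 setT (fun y => wdeg_lo c nb_le d2 X y lu) W12.
  have t1 : t <= 1.
    rewrite leqNgt; apply/negP => t2; have : 2 * uphalf d <= nu (linkE u X) setT.
      by apply: leq_trans ht; rewrite leq_mul2r t2 orbT.
    rewrite uphalfE -divn2; move: hnu a0 md; move: (nu _ _) #|nb u| => v a; lia.
  have : win (linkE u X) (Wp u) setT <= 12 * d * nu (linkE u X) setT + 6 * d.
    apply: leq_trans hw _; rewrite leq_add2l -[X in _ <= X]muln1 leq_mul2l t1 orbT //.
  move: hnu a0 md ha; move: (win _ _ _) (nu _ _) #|nb u| => w v a hnu a0 md ha hw'.
  have : 12 * d * v <= 12 * d * (m - a) by rewrite leq_mul2l; apply/orP; right; lia.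
  by nia.
have [hu|hu] := boolP (hi u).
  have hc : 12 * (2 * nu (linkE u X) setT).+1 <= 12 * (2 * d + 1).
    by move: hnu md; move: (nu _ _) #|nb u| => v a; lia.
  have := small_nu_bound E2 (wdeg_all c G d2 u X) W12 hc.
  move: hu; rewrite hiE.
  move: hnu a0 md ha; move: (win _ _ _) (nu _ _) #|nb u| => w v a hnu a0 md ha hu hw'.
  have h1 : 12 * (2 * d + 1) * v <= 12 * (2 * d + 1) * (m - a) by rewrite leq_mul2l; apply/orP;
    right; lia.
  have h2 : 3 * (m - a) <= m by lia.
  have : a = m - (m - a) by lia.
  move: (m - a) h1 h2 => b h1 h2 def_a;
    have h3 : 18 * b * (d + 1) <= 6 * m * (d + 1) by rewrite leq_mul2r; lia.
  subst a; have bm : b <= m by lia.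
  have -> : d.-1 = d - 1 by lia.
  by nia.
have hc : 12 * (2 * nu (linkE u X) setT).+1 <= 16 * d + 4.
  by move: hnu md lu; rewrite loE; move: (nu _ _) #|nb u| => v a; lia.
have := small_nu_bound E2 (fun y => wdeg_mid c nb_le d2 X y hu) W12 hc.
move: lu; rewrite loE.
move: hnu a0 md ha; move: (win _ _ _) (nu _ _) #|nb u| => w v a hnu a0 md ha lu hw'.
have h1 : (16 * d + 4) * v <= (16 * d + 4) * (m - a) by rewrite leq_mul2l; apply/orP; right; lia.
have h2 : 2 * (m - a) <= m by lia.
have : a = m - (m - a) by lia.
move: (m - a) h1 h2 => b h1 h2 def_a;
  have h3 : 10 * b * (d + 1) <= 6 * m * (d + 1) by rewrite leq_mul2r; lia.
subst a; have bm : b <= m by lia.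
have -> : d.-1 = d - 1 by lia.
by nia.
Qed.

Lemma nb0_lo u : #|nb u| = 0 -> lo u.
Proof. by rewrite loE => ->; lia. Qed.

Lemma wsum_nb0 u X : #|nb u| = 0 -> wsum u X <= win (linkE u X) (Wp u) setT.
Proof. by move=> a0; apply: leq_trans (wsum_le c G3 nb_le u X) _; rewrite a0. Qed.

Lemma win_top u X : lo u -> nu (linkE u X) setT <= d ->
  win (linkE u X) (Wp u) setT <= 12 * d * d + (if odd d then 6 * d else 12 * d).
Proof.
move=> lu hnu; have W12 p : p \in linkE u X -> Wp u p <= 12 by move=> _; apply: Wp_le12.
have [t ht hw] := degree_bound (@linkE_card2 _ _ c G d u X) setT
  (fun y => wdeg_lo c nb_le d2 X y lu) W12.
apply: leq_trans hw _; apply: leq_add; first by rewrite leq_mul2l hnu orbT.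
have htd := leq_trans ht hnu.
have [od|ed] := boolP (odd d).
  rewrite -[X in _ <= X]muln1 leq_mul2l; apply/orP; right.
  by rewrite uphalfE -divn2 in htd; nia.
have : t <= 2 by rewrite uphalfE -divn2 in htd; nia.
by nia.
Qed.

Lemma big_component (K : {set V}) : odd #|K| -> #|K| = (2 * #|K|./2).+1.
Proof. by move=> oK; have := odd_double_half #|K|; rewrite oK; move: #|K| #|K|./2 => *; lia. Qed.

(** Two large odd blocks would need a matching number of at least d. For odd d the one that may
    exist has at most 2d - 1 vertices, so [win_parity] lowers its excess from 6d to 6(d - 1). *)
Lemma win_pred u X (U : {set V}) : lo u -> nu (linkE u X) U < d ->
  win (linkE u X) (Wp u) U <= 12 * d * d.-1 + (if odd d then 6 * d.-1 else 6 * d).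
Proof.
move=> lu hnu; have W12 p : p \in linkE u X -> Wp u p <= 12 by move=> _; apply: Wp_le12.
have E2 := @linkE_card2 _ _ c G d u X.
have D12 := fun y => wdeg_lo c nb_le d2 X y lu.
have t1 t : t * uphalf d <= nu (linkE u X) U -> t <= 1.
  by move=> ht; have := leq_ltn_trans ht hnu; rewrite uphalfE -divn2; nia.
have nu1 : 12 * d * nu (linkE u X) U <= 12 * d * d.-1 by rewrite leq_mul2l; lia.
have [od|ed] := boolP (odd d).
  have [|t ht hw] := @structure_bound _ _ (Wp u) E2 U (12 * d) (6 * d.-1) (uphalf d) D12.
    move=> K _ Kle _ _; have := component_bound E2 K D12 W12.
    case: ifP => // /andP[oK hK] _; have eK := big_component oK.
    have cK : #|K| <= 2 * d - 1 by rewrite eK; move: Kle hnu; move: (nu _ _) #|K|./2 => *; lia.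
    have := win_parity c nb_le d2 X od lu oK cK; rewrite eK.
    by move: (win _ _ _) #|K|./2 => w h; nia.
  apply: leq_trans hw _; apply: leq_add => //.
  by rewrite -[X in _ <= X]muln1 leq_mul2l t1 ?orbT.
have [t ht hw] := degree_bound E2 U D12 W12.
apply: leq_trans hw _; apply: leq_add => //.
by rewrite -[X in _ <= X]muln1 leq_mul2l t1 ?orbT.
Qed.

(** A large odd block does not contain the essential vertex x, so a vertex of the block with d heavy
    neighbours has x as one outside it. Hence every vertex of the block has the slack of
    [wdeg_in_slack]. *)
Lemma win_full u X x : odd d -> lo u -> nu (linkE u X) setT <= d ->
  nu (linkE u X) (setT :\ x) != nu (linkE u X) setT ->
  (forall q : V, nu (linkE u X) (setT :\ q) = nu (linkE u X) setT -> q != x ->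
     #|nb q| = d -> x \in nb q) ->
  win (linkE u X) (Wp u) setT <= 12 * d * d + (6 * d - 18).
Proof.
move=> od lu hnu xess noq.
have W12 p : p \in linkE u X -> Wp u p <= 12 by move=> _; apply: Wp_le12.
have E2 := @linkE_card2 _ _ c G d u X.
have D12 := fun y => wdeg_lo c nb_le d2 X y lu.
have [|t ht hw] := @structure_bound _ _ (Wp u) E2 setT (12 * d) (6 * d - 18) (uphalf d) D12.
  move=> K _ _ iness mlt; have := component_bound E2 K D12 W12.
  case: ifP => // /andP[oK hK] _; have eK := big_component oK.
  have {mlt} := mlt oK x (in_setT x) xess => mlt.
  have cK : #|K| <= 2 * d - 1 by rewrite eK; move: mlt hnu; move: (nu _ _) #|K|./2 => *; lia.
  have xK : x \notin K by apply: contra xess => xK; rewrite iness.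
  have small y : y \in K -> hdeg_in c G d u X K y < d.
    move=> yK; rewrite ltnNge; apply/negP => hy.
    have nyx : y != x by apply: contraNneq xK => <-.
    have ny : d <= #|nb y :&: K|.
      apply: leq_trans hy _; apply: (@heavy_at_le _ _ c G d u X y _ (fun p => p \subset K)).
      by move=> z _ _ /subsetP h zn; rewrite inE zn h // !inE eqxx orbT.
    have ny' : #|nb y :&: K| <= #|nb y| by apply: leq_cards; apply: subsetIl.
    have xn : x \in nb y.
      by apply: noq => //; [apply: iness|move: ny ny' (nb_le y); card_lia].
    have : #|nb y :&: K| <= #|nb y :\ x|.
      apply: leq_cards; apply/subsetP => z /setIP[zn zK]; rewrite in_setD1 zn andbT.
      by apply: contraNneq xK => <-.
    by have := nb_le y; rewrite (cardsD1 x) xn; move: ny; card_lia.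
  have := win_slack nb_le d2 lu (subxx K) cK small.
  (* Here d >= 3. The slack is at least 5 times 9, and 36 of it lowers the excess from 6d to 6d -
     18. *)
  have K5 : 5 <= #|K| by rewrite eK; move: hK; rewrite uphalfE -divn2; move: od;
    move: #|K|./2 => h; lia.
  move: K5; rewrite eK; move: (win _ _ _) #|K|./2 => w h; nia.
apply: leq_trans hw _; apply: leq_add; first by rewrite leq_mul2l hnu orbT.
have t1 : t <= 1 by have := leq_trans ht hnu; rewrite uphalfE -divn2; nia.
by rewrite -[X in _ <= X]muln1 leq_mul2l t1 orbT.
Qed.
End VertexBounds.

(** * Counting *)

Section Count.
Variables (V T : finType) (c : {set V} -> T) (G : {set {set V}}) (d : nat).
Local Notation k := d.+1.
Local Notation nb := (nb G d).
Local Notation linkE := (linkE c G d).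
Local Notation Wp := (Wp G d).
Local Notation wsum := (wsum c G d).
Local Notation robust := (robust c d).
Implicit Types (x y u v w q : V) (M : {set {set V}}) (p e : {set V}) (X : {set T}) (r : T).
Hypothesis G3 : forall e, e \in G -> #|e| = 3.
Hypothesis no_rainbow : forall x M, rstar c x M -> #|M| <= k.
Hypothesis Ginj : forall e e', e \in G -> e' \in G -> c e = c e' -> e = e'.
Hypothesis d2 : 2 <= d.
Hypothesis nV : 4 * k * k + 4 * k + 3 <= #|V|.

(* Twelve times the Chvatal-Hanson number, the maximal number of edges of a graph with
   maximum degree and matching number at most d; for weighted graphs and odd d the
   bound is weaker by eps. *)
Definition CH12 := 12 * d * d + (if odd d then 6 * d - 6 else 12 * d).
Definition eps := if odd d then 6 else 0.

Lemma zone_size : 2 * k * k + 2 * k + 3 <= #|V|.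
Proof. by apply: leq_trans nV; lia. Qed.

Lemma robust_ex x : exists r, robust x r.
Proof. by have [Z [_ _ _]] := robust_zone no_rainbow d2 x zone_size. Qed.

Lemma nb_le_d u : #|nb u| <= d.
Proof.
have [r rob] := robust_ex u.
have := nu_linkE1 no_rainbow Ginj d2 rob (set11 r).
by apply: leq_trans; rewrite leq_addl.
Qed.

Lemma odd_d3 : odd d -> 3 <= d.
Proof. by move: d2; case: (d) => [|[|[|]]]. Qed.

Lemma wsum_robust u X r : robust u r -> r \in X -> wsum u X <= CH12 + eps.
Proof.
move=> rob rX; have hnu := nu_linkE1 no_rainbow Ginj d2 rob rX.
have [a0|a0] := posnP #|nb u|; last first.
  apply: leq_trans (wsum_pos G3 nb_le_d d2 a0 hnu (leqnn d)) _.
  by rewrite /CH12 -addnA leq_addr.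
rewrite a0 addn0 in hnu; apply: leq_trans (wsum_nb0 c G3 nb_le_d X a0) _.
apply: leq_trans (win_top nb_le_d d2 (nb0_lo d2 a0) hnu) _.
by rewrite /CH12 /eps; case: ifP => [/odd_d3|]; lia.
Qed.

(** The 36 consists of the saving of 12 asked from typical vertices and of 24 for the two edges of
    [G] that [main_bound] drops on account of u. *)
Lemma wsum_multi u X r r' : robust u r -> robust u r' -> r != r' -> r \in X -> r' \in X ->
  wsum u X + 36 <= CH12.
Proof.
move=> rob rob' nrr rX rX'; have hnu := nu_linkE2 no_rainbow Ginj d2 rob rob' nrr rX rX'.
have [a0|a0] := posnP #|nb u|; last first.
  have hnu' : nu (linkE u X) setT + #|nb u| <= d.-1 by move: hnu; move: (nu _ _ + _) => m; lia.
  have := wsum_pos G3 nb_le_d d2 a0 hnu' (leq_pred d); rewrite /CH12.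
  by case: ifP => [/odd_d3|_]; move: (wsum u X); have -> : d.-1 = d - 1 by [lia]; nia.
rewrite a0 addn0 in hnu; have := wsum_nb0 c G3 nb_le_d X a0.
have := win_pred nb_le_d d2 (nb0_lo d2 a0) hnu; rewrite /CH12.
by case: ifP => [/odd_d3|_]; move: (wsum u X) (win _ _ _); have -> : d.-1 = d - 1 by [lia]; nia.
Qed.

Section Generic.
Variables (c0 : T) (x : V) (Z : {set V}).
Hypothesis x_bad : ~~ robust x c0.
Hypothesis cZ : #|Z| <= 2 * k * k.
Hypothesis zoneZ : forall y w, y != w -> y != x -> w != x -> y \notin Z -> w \notin Z ->
  robust x (c (x |: [set y; w])).
Let Rx := [set r | robust x r].
Let X := c0 |: Rx.
Let L := [set u | [exists e in G, [&& u != x, u \in e, x \in e & [disjoint e & nb x]]]].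

Lemma no_k_star u M U p r : robust u c0 -> matching (linkE u X) M U -> d <= #|M| ->
  #|p| = 2 -> u \notin p -> [disjoint p & cover M] -> c (u |: p) = r -> r \in Rx -> False.
Proof.
move=> rob mM cM p2 up dp cp rR; have /and3P[sM _ _] := mM.
have colM (s : {set V}) : s \in M -> c (u |: s) \notin X by move/(subsetP sM)/linkE_color => [].
have sMu := linkE_rstar Ginj mM.
have [|sM' cM'] := rstar_add sMu p2 up dp.
  by move=> s /colM; rewrite cp => h e; move: h; rewrite e (setU1r c0 rR).
suff : #|p |: M| <= d by rewrite cM' ltnNge cM.
apply: (robust1 no_rainbow rob sM') => s /setU1P[->|/colM].
  by rewrite cp => e; move: rR; rewrite e inE (negPf x_bad).
by move=> h e; move: h; rewrite e setU11.
Qed.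

Lemma card_cover_link u M U : matching (linkE u X) M U -> #|cover M| <= 2 * k.
Proof.
move=> mM; rewrite (card_cover_matching (@linkE_card2 _ _ c G d u X) mM) leq_mul2l /=.
exact: no_rainbow (linkE_rstar Ginj mM).
Qed.

(** For v outside [Z] the edge uxv has a color robust at x, so the pair xv would extend a matching
    of d edges against [no_k_star]. *)
Lemma nu_generic u : robust u c0 -> u != x -> u \notin Z -> nu (linkE u X) (setT :\ x) < d.
Proof.
move=> rob nux uZ; rewrite ltnNge; apply/negP => hd.
have [M mM cM] := nu_ex (linkE u X) (setT :\ x); rewrite -cM in hd.
have cc := card_cover_link mM.
have [|v _] := @card_ltn_ex _ [set: V] (cover M :|: Z :|: [set x; u]).
  have := cardsU_le (cover M :|: Z) [set x; u]; have := cardsU_le (cover M) Z.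
  by rewrite cardsT cards2; move: cc cZ nV; case: (x != u) => /=; card_lia.
rewrite !in_setU !negb_or in_set1 in_set1 => /andP[/andP[vM vZ] /andP[nvx nvu]].
have e : u |: [set x; v] = x |: [set u; v] by rewrite setUCA.
have xM : x \notin cover M.
  by case/and3P: mM => _ _ /subsetP h; apply/negP => /h; rewrite !inE eqxx.
apply: (@no_k_star u M (setT :\ x) [set x; v] _ rob mM hd _ _ _ (erefl _)).
- by rewrite cards2 eq_sym nvx.
- by rewrite !inE negb_or nux eq_sym.
- by rewrite disjoints_subset subUset !sub1set !inE xM.
- by rewrite inE e zoneZ // eq_sym.
Qed.

(** Up to one edge of color r, the edges at x avoiding [nb x] form a graph of degree at most 2d + 1
    and matching number at most d, hence with at most (2d + 1)d edges. *)
Lemma card_light : #|L| <= 2 * (2 * d + 1) * d + 3.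
Proof.
have [r rob] := robust_ex x.
have hnu : nu (linkE x [set r]) setT <= d.
  by apply: leq_trans (nu_linkE1 no_rainbow Ginj d2 rob (set11 r)); apply: leq_addr.
have E2 := @linkE_card2 _ _ c G d x [set r].
have cE : #|linkE x [set r]| <= (2 * d + 1) * d.
  have -> : #|linkE x [set r]| = win (linkE x [set r]) (fun=> 1) setT.
    by rewrite /win sum1dep_card; apply: eq_card => p; rewrite !inE subsetT andbT.
  apply: leq_trans (small_nu_bound (D := 2 * d + 1) (c := 1) E2 _ _ _) _ => //.
  - move=> y; rewrite /wdeg sum1dep_card; apply: leq_trans (link_codeg c G d2 x [set r] y).
    by apply: leq_cards; apply/subsetP => p; rewrite inE => /andP[h1 h2]; apply/setIdP;
      rewrite h2.
  - by move: hnu; move: (nu _ _) => *; lia.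
  - by rewrite leq_mul2l hnu orbT.
pose Er := [set e in G | c e == r].
have cEr : #|cover Er| <= 3.
  have [->|/set0Pn[e0 /setIdP[e0G /eqP e0r]]] := eqVneq Er set0;
    first by rewrite /cover big_set0 cards0.
  rewrite -(G3 e0G); apply: leq_cards; apply/bigcupsP => e /setIdP[eG /eqP er].
  by rewrite (Ginj eG e0G) // er.
have cc : #|cover (linkE x [set r])| <= 2 * #|linkE x [set r]|.
  apply: leq_trans (leq_card_cover _) _; rewrite mulnC -sum_nat_const.
  by apply: leq_sum => p /E2->.
have sL : L \subset cover (linkE x [set r]) :|: cover Er.
  apply/subsetP => u; rewrite inE => /exists_inP[e eG /and4P[nux ue xe de]].
  have [er|er] := eqVneq (c e) r.
    by apply/setUP; right; apply/bigcupP; exists e => //; apply/setIdP; rewrite er.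
  apply/setUP; left; apply/bigcupP; exists (e :\ x); last by rewrite !inE nux.
  have := G3 eG; rewrite (cardsD1 x) xe add1n => -[] e2; rewrite inE; apply/and5P; split.
  - by rewrite e2.
  - by rewrite !inE eqxx.
  - exact: disjointWl (subD1set e x) de.
  - by rewrite setD1K.
  - by rewrite setD1K // inE.
have := leq_cards sL; have := cardsU_le (cover (linkE x [set r])) (cover Er).
by move: cE cEr cc; rewrite -mulnA; card_lia.
Qed.

(** A light pair at x in the link of u would be an edge of [G] through u and x avoiding [nb x], and
    put u into [L]. *)
Lemma wdeg_x u : #|nb u| = 0 -> u != x -> u \notin L ->
  wdeg (linkE u X) (Wp u) x <= 12 * #|nb x|.
Proof.
move=> a0 nux uL; rewrite wdegT.
have := @star_weight _ _ c G d u X x 0 xpredT; rewrite !mul0n !addn0 => h.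
apply: leq_trans (h _) _ => [p pE xp hp|]; last by rewrite leq_mul2l /=; apply: heavy_at_le.
move/negP: uL; case; rewrite inE; apply/exists_inP; exists (u |: p).
  by have [] := linkE_color pE.
rewrite nux !inE eqxx xp orbT /= disjoints_subset subUset sub1set inE.
have un : u \notin nb x by rewrite nbC; move/eqP: a0; rewrite cards_eq0 => /eqP->; rewrite inE.
rewrite un /=; apply/subsetP => z zp; rewrite inE.
have [->|nzx] := eqVneq z x; first exact: nb_irr.
rewrite mem_nb 1?eq_sym //.
have p2 := linkE_card2 pE; rewrite (_ : [set x; z] = p) //; apply/eqP.
by rewrite eqEcard subUset !sub1set xp zp p2 cards2 eq_sym nzx.
Qed.

Lemma win_delete u : win (linkE u X) (Wp u) setT <=
  wdeg (linkE u X) (Wp u) x + win (linkE u X) (Wp u) (setT :\ x).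
Proof.
apply: leq_trans (win_split _ _ setT (setT :\ x)) _.
by rewrite setTI setDDr setDv set0U setTI big_set1.
Qed.

(* Full vertices that are not heavy neighbours have the same robust color, so the
   star M at u, which misses q, can be extended through q. *)
Lemma inessential_full u q : robust u c0 -> #|nb u| = 0 -> #|nb x| = d ->
  d <= nu (linkE u X) (setT :\ q) -> q != x -> #|nb q| = d -> x \in nb q.
Proof.
move=> rob a0 xfull hnu nqx qfull; apply/negPn/negP => xq.
have [rx robx] := robust_ex x; have [rq robq] := robust_ex q.
have [M mM cM] := nu_ex (linkE u X) (setT :\ q); rewrite -cM in hnu.
have nuq : u != q by apply: contra_eq_neq qfull => <-; rewrite a0; lia.
have uq : u \notin nb q by rewrite nbC; move/eqP: a0; rewrite cards_eq0 => /eqP->; rewrite inE.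
have qx : q \notin nb x by rewrite nbC.
have ccM := card_cover_link mM.
have qM : q \notin cover M.
  by case/and3P: mM => _ _ /subsetP h; apply/negP => /h; rewrite !inE eqxx.
have [|v _] := @card_ltn_ex _ [set: V] (nb x :|: nb q :|: [set x; q]).
  have := cardsU_le (nb x :|: nb q) [set x; q]; have := cardsU_le (nb x) (nb q).
  rewrite cardsT cards2 xfull qfull; move: nV; case: (x != q) => /=; card_lia.
rewrite !in_setU !negb_or in_set1 in_set1 => /andP[/andP[vnx vnq] /andP[nvx nvq]].
have erho : rx = rq.
  rewrite -(full_color no_rainbow Ginj d2 xfull robx (p := [set q; v])).
  - rewrite -(full_color no_rainbow Ginj d2 qfull robq (p := [set x; v])).
    + by rewrite setUCA.
    + by rewrite cards2 eq_sym nvx.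
    + by rewrite !inE negb_or nqx eq_sym.
    + by rewrite disjoints_subset subUset !sub1set !in_setC xq.
  - by rewrite cards2 eq_sym nvq.
  - by rewrite !inE negb_or ![x == _]eq_sym nqx.
  - by rewrite disjoints_subset subUset !sub1set !in_setC qx.
have [|w _] := @card_ltn_ex _ [set: V] (cover M :|: nb q :|: [set u; q]).
  have := cardsU_le (cover M :|: nb q) [set u; q]; have := cardsU_le (cover M) (nb q).
  rewrite cardsT cards2 qfull; move: nV ccM; case: (u != q) => /=; card_lia.
rewrite !in_setU !negb_or in_set1 in_set1 => /andP[/andP[wM wnq] /andP[nwu nwq]].
apply: (@no_k_star u M (setT :\ q) [set q; w] rx rob mM hnu).
- by rewrite cards2 eq_sym nwq.
- by rewrite !inE negb_or nuq eq_sym.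
- by rewrite disjoints_subset subUset !sub1set !in_setC qM.
- rewrite erho -(full_color no_rainbow Ginj d2 qfull robq (p := [set u; w])).
  + by rewrite setUCA.
  + by rewrite cards2 eq_sym nwu.
  + by rewrite !inE negb_or ![q == _]eq_sym nuq.
  + by rewrite disjoints_subset subUset !sub1set !in_setC uq.
- by rewrite inE.
Qed.

Lemma wsum_generic u : robust u c0 -> u \notin x |: (Z :|: L) -> wsum u X + 12 <= CH12.
Proof.
move=> rob; rewrite !in_setU in_set1 !negb_or => /and3P[nux uZ uL].
have hnu := nu_linkE1 no_rainbow Ginj d2 rob (setU11 c0 Rx); rewrite -/X in hnu.
have [a0|a0] := posnP #|nb u|; last first.
  have := wsum_pos G3 nb_le_d d2 a0 hnu (leqnn d); rewrite /CH12.
  by case: ifP => [/odd_d3|_]; move: (wsum u X); nia.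
rewrite a0 addn0 in hnu; have lu := nb0_lo d2 a0.
have ws := wsum_nb0 c G3 nb_le_d X a0.
have nux' := nu_generic rob nux uZ.
have wp := win_pred nb_le_d d2 lu nux'; have wd := win_delete u.
rewrite /CH12; move: wp; have [od|ed] := boolP (odd d) => wp; last first.
  have := wdeg_lo c nb_le_d d2 X x lu; move: ws wp wd.
  move: (wsum u X) (wdeg _ _ _) (win _ _ (setT :\ x)) (win _ _ setT) => a1 a2 a3 a4.
  by have -> : d.-1 = d - 1 by [lia]; nia.
have d3 := odd_d3 od.
(* Below d, the link without x has at most 12d(d - 1) + 6(d - 1) and x adds at most 12(d - 1), which
   is exactly [CH12] - 12. Heavy degree d would give 12 too much and takes the route through
   [win_full]. *)
have [xnf|xf] := ltnP #|nb x| d.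
  have := wdeg_x a0 nux uL; move: ws wp wd xnf.
  move: (wsum u X) (wdeg _ _ _) (win _ _ (setT :\ x)) (win _ _ setT) #|nb x| => a1 a2 a3 a4 a5.
  by have -> : d.-1 = d - 1 by [lia]; nia.
have xfull : #|nb x| = d by apply/eqP; rewrite eqn_leq nb_le_d.
have [lt|ge] := ltnP (nu (linkE u X) setT) d.
  have := win_pred nb_le_d d2 lu lt; rewrite od; move: ws.
  move: (wsum u X) (win _ _ setT) => a1 a2.
  by have -> : d.-1 = d - 1 by [lia]; nia.
have hw : win (linkE u X) (Wp u) setT <= 12 * d * d + (6 * d - 18).
  apply: (win_full nb_le_d d2 od lu hnu (x := x)).
    by rewrite neq_ltn (leq_trans nux' ge).
  by move=> q hq; apply: (inessential_full rob a0 xfull); rewrite hq.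
move: ws hw; move: (wsum u X) (win _ _ setT) => a1 a2; nia.
Qed.
End Generic.

(** Two vertices with one robust color each, outside each other's zones, lie in a common edge whose
    color is robust at both. So every disagreement is recorded in a zone, of size at most 2k^2, and
    on average a vertex has at most 4k^2 of them. *)
Lemma common_color : exists c0,
  #|[set u | (#|[set r | robust u r]| <= 1) && ~~ robust u c0]| <= 4 * k * k.
Proof.
have [Z hZ] := fin_all_exists (fun x => robust_zone no_rainbow d2 x zone_size).
have [r hr] := fin_all_exists robust_ex.
pose S := [set u | #|[set s | robust u s]| <= 1].
have uniqR u s : u \in S -> robust u s -> s = r u.
  by rewrite inE => /card_le1_eqP h rob; apply: h; rewrite inE.
have [S0|/set0Pn[x0 x0S]] := eqVneq S set0.
  have /card_gt0P[v _] : 0 < #|V| by apply: leq_trans nV; rewrite addn3.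
  exists (r v); rewrite (_ : [set u | _] = set0) ?cards0 //; apply/setP => u.
  by move/setP: S0 => /(_ u); rewrite !inE => ->.
have cross x u : x \in S -> u \in S -> r u != r x -> (u \in Z x) || (x \in Z u).
  move=> xS uS; apply: contraR; rewrite negb_or => /andP[uZ xZ].
  have [->//|nux] := eqVneq u x.
  have [cx zx _ _] := hZ x; have [cu zu _ _] := hZ u.
  have [|w _] := @card_ltn_ex _ [set: V] (Z x :|: Z u :|: [set x; u]).
    have := cardsU_le (Z x :|: Z u) [set x; u]; have := cardsU_le (Z x) (Z u).
    by rewrite cardsT cards2; move: cx cu nV; case: (x != u) => /=; card_lia.
  rewrite !in_setU !negb_or in_set1 in_set1 => /andP[/andP[wZx wZu] /andP[nwx nwu]].
  have rx : robust x (c (x |: [set u; w])) by apply: zx; rewrite // eq_sym.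
  have ru : robust u (c (u |: [set x; w])) by apply: zu; rewrite // eq_sym.
  by rewrite -(uniqR _ _ xS rx) -(uniqR _ _ uS ru) setUCA.
suff /exists_inP[x xS hx] : [exists x in S, #|[set u in S | r u != r x]| <= 4 * k * k].
  exists (r x); apply: leq_trans hx; apply: leq_cards; apply/subsetP => u.
  rewrite inE => /andP[uS nrob]; apply/setIdP; rewrite inE; split=> //.
  by apply: contraNneq nrob => <-.
apply: contraT => /exists_inPn nx; exfalso.
have sum1 : #|S| * (4 * k * k).+1 <= \sum_(x in S) #|[set u in S | r u != r x]|.
  by rewrite -sum_nat_const; apply: leq_sum => x xS; rewrite ltnNge nx.
have sum2 : \sum_(x in S) #|[set u in S | r u != r x]| <=
    \sum_(x in S) (#|Z x| + #|[set u in S | x \in Z u]|).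
  apply: leq_sum => x xS; apply: leq_trans (cardsU_le _ _); apply: leq_cards.
  apply/subsetP => u /setIdP[uS nr]; apply/setUP.
  by case/orP: (cross x u xS uS nr) => h; [left|right; apply/setIdP].
have cZk x : #|Z x| <= 2 * k * k by case: (hZ x).
have sum3 : \sum_(x in S) #|[set u in S | x \in Z u]| <= #|S| * (2 * k * k).
  under eq_bigr => x _ do rewrite -sum1dep_card big_mkcondr /=.
  rewrite exchange_big -sum_nat_const /=; apply: leq_sum => u uS.
  rewrite -big_mkcondr sum1dep_card; apply: leq_trans (cZk u); apply: leq_cards.
  by apply/subsetP => x; rewrite inE => /andP[].
have sum4 : \sum_(x in S) #|Z x| <= #|S| * (2 * k * k).
  by rewrite -sum_nat_const; apply: leq_sum.
have : 0 < #|S| by apply/card_gt0P; exists x0.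
move: sum1 sum2; rewrite big_split /=; move: sum3 sum4.
move: (\sum_(x in S) #|[set u in S | x \in Z u]|) (\sum_(x in S) #|Z x|).
move: (\sum_(x in S) _) #|S| => s1 s s2 s3; nia.
Qed.

Lemma main_bound : (forall c0, exists x, ~~ robust x c0) ->
  12 * #|G| + 12 * #|V| <= CH12 * #|V| + (12 + eps) * (6 * k * k + 2 * (2 * d + 1) * d + 4)
    + 12 * (1 + k + 4 * k * k).
Proof.
move=> bad; have [c0 cE] := common_color; have [x xbad] := bad c0.
have [Z [cZ zoneZ cRx _]] := robust_zone no_rainbow d2 x zone_size.
have [r hr] := fin_all_exists robust_ex.
pose R u := [set s | robust u s].
pose Mu := [set u | 1 < #|R u|].
pose E := [set u | (#|R u| <= 1) && ~~ robust u c0]; rewrite -/E in cE.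
have exg u : exists Y : {set T}, u \in Mu -> #|Y| = 2 /\ Y \subset R u.
  have [uM|] := boolP (u \in Mu); last by exists set0.
  by move: uM; rewrite inE => /ex_subset[Y sY cY]; exists Y.
have {exg}[g hg] := fin_all_exists exg.
pose L := [set u | [exists e in G, [&& u != x, u \in e, x \in e & [disjoint e & nb x]]]].
pose B := x |: (Z :|: L).
have cB : #|B| <= 2 * k * k + (2 * (2 * d + 1) * d + 3) + 1.
  have := cardsU_le [set x] (Z :|: L); have := cardsU_le Z L; rewrite cards1.
  by have := card_light xbad cZ; rewrite -/L -/B; move: cZ; card_lia.
(* The colors dropped at u cost one edge of [G] each. Those of [Mu] may be numerous but are paid for
   by [wsum_multi]; [E] is small, and all other vertices share the same at most k + 1 colors. *)
pose Xu u := if u \in Mu then g u else if u \in E then [set r u] else c0 |: R x.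
pose Xall := (c0 |: R x) :|: [set r u | u in E] :|: \bigcup_(u in Mu) g u.
have sXu u : Xu u \subset Xall.
  rewrite /Xu; case: ifP => [uM|_].
    by apply: subset_trans (subsetUr _ _); apply: (bigcup_sup u).
  case: ifP => [uE|_]; last by rewrite /Xall -setUA; apply: subsetUl.
  rewrite sub1set /Xall; apply/setUP; left; apply/setUP; right.
  by apply/imsetP; exists u.
have cXall : #|Xall| <= 1 + k + #|E| + 2 * #|Mu|.
  apply: leq_trans (cardsU_le _ _) _; apply: leq_add.
    apply: leq_trans (cardsU_le _ _) _; apply: leq_add; last exact: leq_imset_card.
    by apply: leq_trans (cardsU_le _ _) _; rewrite cards1 leq_add2l.
  rewrite mulnC -sum_nat_const; apply: leq_trans (_ : \sum_(u in Mu) #|g u| <= _).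
    elim/big_rec2: _ => [|u m Y _ IH]; first by rewrite cards0.
    by apply: leq_trans (cardsU_le _ _) _; apply: leq_add.
  by apply: leq_sum => u /hg[->].
pose G' := [set e in G | c e \notin Xall].
have cG : #|G| <= #|G'| + #|Xall|.
  rewrite -(cardsID [set e | c e \notin Xall] G).
  apply: leq_add; first by apply: leq_cards; apply/subsetP => e; rewrite !inE.
  rewrite -(card_in_imset (_ : {in G :\: [set e | c e \notin Xall] &, injective c})).
    by apply: leq_cards; apply/subsetP => _ /imsetP[e /setDP[_ eX] ->]; move: eX;
      rewrite inE negbK.
  by move=> e e' /setDP[eG _] /setDP[eG' _]; apply: Ginj.
have sumw : 12 * #|G'| <= \sum_(u : V) wsum u (Xu u).
  rewrite mulnC -sum_nat_const;
    apply: leq_trans (_ : \sum_(e in G') \sum_(u in e) wt G d u e <= _).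
    by apply: leq_sum => e /setIdP[eG _]; apply: wt_sum; rewrite ?G3.
  rewrite /wsum (exchange_big_dep xpredT) //=; apply: leq_sum => u _.
  rewrite [X in _ <= X]big_mkcond [X in X <= _]big_mkcond; apply: leq_sum => e _ /=.
  case: ifP => // /andP[/setIdP[eG eX] ue]; rewrite eG ue /=.
  by rewrite ifT //; apply: contra eX; apply: (subsetP (sXu u)).
(* Only vertices of [E] or [B] may exceed the target [CH12] - 12, by at most 12 + [eps]. *)
have bound u : wsum u (Xu u) + 12 + 24 * (u \in Mu) <=
    CH12 + (12 + eps) * ((u \in E) + (u \in B)).
  have [uM|uM] := boolP (u \in Mu).
    have [/eqP/cards2P[s [s' [nss def_g]]] sg] := hg u uM.
    have : wsum u (Xu u) + 36 <= CH12.
      rewrite /Xu uM; apply: (@wsum_multi u (g u) s s'); rewrite // ?def_g ?inE ?eqxx ?orbT //.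
        by have := subsetP sg s; rewrite def_g !inE eqxx => /(_ isT).
      by have := subsetP sg s'; rewrite def_g !inE eqxx orbT => /(_ isT).
    by move: (wsum _ _) CH12 ((_ + eps) * _) => a1 a2 a3 /=; lia.
  rewrite muln0 addn0; have [uE|uE] := boolP (u \in E).
    have : wsum u (Xu u) <= CH12 + eps.
      by rewrite /Xu (negPf uM) uE; apply: (wsum_robust (hr u)); rewrite inE.
    by move: (wsum _ _) CH12 eps (u \in B) => a1 a2 a3 a4 /=; nia.
  have rob : robust u c0.
    by move: uM uE; rewrite !inE -leqNgt => ->; rewrite negbK.
  rewrite /Xu (negPf uM) (negPf uE); have [uB|uB] := boolP (u \in B).
    have := wsum_robust rob (setU11 c0 (R x)).
    by move: (wsum _ _) CH12 eps => a1 a2 a3 /=; nia.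
  by rewrite muln0 addn0; apply: (wsum_generic xbad cZ zoneZ rob uB).
have : \sum_(u : V) (wsum u (Xu u) + 12 + 24 * (u \in Mu)) <=
    \sum_(u : V) (CH12 + (12 + eps) * ((u \in E) + (u \in B))).
  by apply: leq_sum.
have cardE (Y : {set V}) : \sum_(u : V) (u \in Y : nat) = #|Y|.
  rewrite -sum1_card [RHS]big_mkcond; apply: eq_bigr => u _; by case: (u \in Y).
have cT : #|[pred _ : V | true]| = #|V| by apply: eq_card.
have lhs : \sum_(u : V) (wsum u (Xu u) + 12 + 24 * (u \in Mu)) =
    \sum_(u : V) wsum u (Xu u) + #|V| * 12 + 24 * #|Mu|.
  rewrite (big_split _ _ _ (fun u => wsum u (Xu u) + 12) (fun u => 24 * (u \in Mu))) /=.
  rewrite (big_split _ _ _ (fun u => wsum u (Xu u)) (fun=> 12)) /=.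
  by rewrite sum_nat_const cT -(cardE Mu) big_distrr.
have rhs : \sum_(u : V) (CH12 + (12 + eps) * ((u \in E) + (u \in B))) =
    #|V| * CH12 + (12 + eps) * (#|E| + #|B|).
  rewrite (big_split _ _ _ (fun=> CH12) (fun u => (12 + eps) * ((u \in E) + (u \in B)))) /=.
  by rewrite sum_nat_const cT -(cardE E) -(cardE B) -big_split big_distrr.
rewrite lhs rhs.
have hEB : (12 + eps) * (#|E| + #|B|) <= (12 + eps) * (6 * k * k + 2 * (2 * d + 1) * d + 4).
  by rewrite leq_mul2l; apply/orP; right; move: cB cE; card_lia.
rewrite [#|V| * CH12]mulnC; move: cE cG cXall sumw hEB.
move: (CH12 * #|V|) ((12 + eps) * _) ((12 + eps) * _) (\sum_(i : V) _) => P1 P2 P3 P4.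
card_lia.
Qed.
End Count.

(** * Numerical comparison and conclusion *)

Lemma size_bound (k n : nat) :
  (5 / 2 * k%:R ^+ 3 + 15 / 2 * k%:R ^+ 2 + 26 * k%:R - 3 < n%:R :> rat)%R ->
  5 * (k * k * k) + 15 * (k * k) + 52 * k < 2 * n + 6.
Proof.
move=> hn; rewrite -(Num.Theory.ltr_nat rat) !GRing.natrD !GRing.natrM.
by move: hn; rewrite !GRing.exprSr GRing.expr0 !GRing.mul1r; move: (k%:R)%R (n%:R)%R => K N hn;
  lra.
Qed.

(** What remains to be checked for odd d: the counting gives 2n <= 4k^3 + 30k^2 - 13k + 16, while 2n
    >= 5k^3 + 15k^2 + 52k - 5 by hypothesis. *)
Lemma cubic_bound k : 3 <= k -> 15 * (k * k) + 22 <= k * k * k + 65 * k.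
Proof.
case: k => [|[|[|j]]] // _; have [lt|ge] := ltnP j 6; last by nia.
by case: j lt => [|[|[|[|[|[|j]]]]]].
Qed.

Lemma no_rainbow_colors d n t (c : {ffun {set 'I_n} -> 'I_t}) : 2 <= d ->
  4 * d.+1 * d.+1 + 4 * d.+1 + 3 <= n -> t = star_turan n d.+1 + 2 ->
  exact_coloring c -> ~~ has_rainbow_copy c (star d.+2) ->
  12 * t + 12 * n <= CH12 d * n
    + (12 + eps d) * (6 * d.+1 * d.+1 + 2 * (2 * d + 1) * d + 4)
    + 12 * (1 + d.+1 + 4 * d.+1 * d.+1).
Proof.
move=> d2 nV def_t ex nrb.
have exE (j : 'I_t) : exists e : {set 'I_n}, e \in complete3 'I_n /\ c e = j.
  have : j \in c @: complete3 'I_n by rewrite (eqP ex) in_setT.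
  by case/imsetP => e eC ->; exists e.
have {exE}[g hg] := fin_all_exists exE.
pose G := [set g j | j : 'I_t].
have gK j : c (g j) = j by case: (hg j).
have Ginj e e' : e \in G -> e' \in G -> c e = c e' -> e = e'.
  by case/imsetP => j _ -> /imsetP[j' _ ->]; rewrite !gK => ->.
have G3 e : e \in G -> #|e| = 3.
  by case/imsetP => j _ ->; case: (hg j); rewrite inE => /eqP.
have cG : #|G| = t.
  by rewrite card_imset ?card_ord // => j j' e; rewrite -(gK j) e gK.
have no_rainbow x M : rstar c x M -> #|M| <= d.+1.
  move=> /rstarP[sM inj]; rewrite leqNgt; apply/negP => /ex_subset[N sN cN].
  move/rainbow_starP: nrb; apply; exists x, N; split=> //.
    exact: smatch_sub sN sM.
  by move=> p q pN qN; apply: inj; apply: (subsetP sN).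
have cV : #|'I_n| = n by rewrite card_ord.
have key := @main_bound _ _ c G d G3 no_rainbow Ginj d2.
rewrite cV cG in key; apply: key => // c0; pose G0 := G :\ g c0.
have cG0 : star_turan n d.+1 < #|G0|.
  have : g c0 \in G by apply/imsetP; exists c0.
  by move=> gG; move: cG; rewrite (cardsD1 (g c0)) gG def_t -/G0; card_lia.
have : contains_copy G0 (star d.+1).
  apply: contraLR cG0 => /star_turan_ge h; rewrite -leqNgt; apply: h.
  apply/subsetP => e /setD1P[_ /G3 e3]; by rewrite inE e3.
case/contains_starP => x [M [sM cM MG]]; exists x; apply/negP => rob.
have MG' p : p \in M -> x |: p \in G by move/MG/setD1P => [].
have /smatchP[_ _ h3] := sM.
have rM : rstar c x M.
  apply/rstarP; split=> // p q pM qM /(Ginj _ _ (MG' p pM) (MG' q qM)).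
  by apply: setU1_inj; apply: h3.
suff : #|M| <= d by rewrite cM ltnn.
apply: (robust1 no_rainbow rob rM) => p pM e.
have /setD1P[/eqP ne _] := MG p pM; apply: ne; apply: Ginj; rewrite ?MG' //.
  by apply/imsetP; exists c0.
by rewrite e gK.
Qed.

Lemma forced_colors d n : 2 <= d ->
  5 * (d.+1 * d.+1 * d.+1) + 15 * (d.+1 * d.+1) + 52 * d.+1 < 2 * n + 6 ->
  ar_forces n (star d.+2) (star_turan n d.+1 + 2).
Proof.
move=> d2 hn; apply/andP; split; first by rewrite addn2.
apply/forallP => c; apply/implyP => ex; apply: contraT => nrb; exfalso.
have nV : 4 * d.+1 * d.+1 + 4 * d.+1 + 3 <= n by nia.
have := no_rainbow_colors d2 nV (erefl _) ex nrb.
have cub := @cubic_bound d.+1 d2.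
have [od|ed] := boolP (odd d).
  pose r := d./2; have def_d : d = 2 * r + 1.
    by have := odd_double_half d; rewrite od -mul2n /r; lia.
  have hT := @star_turan_even n d r def_d ltac:(nia).
  have [m def_n] : exists m, n = 2 * d + 1 + m by exists (n - (2 * d + 1)); nia.
  have e1 : n - (2 * d + 1) = m by lia.
  rewrite /CH12 /eps od; move: hT; rewrite e1.
  have -> : 12 * d * d + (6 * d - 6) = 12 * (d * d + r) by lia.
  move: (star_turan _ _) => f hT.
  have -> : 12 * (d * d + r) * n = 12 * ((d * d + r) * m) + 12 * (d * d + r) * (2 * d + 1)
    by rewrite def_n; nia.
  move: ((d * d + r) * m) hT => P hT h.
  have {h hT} : 12 * n + 24 <= 12 * (d * d + r) * (2 * d + 1) + 18 * (6 * d.+1 * d.+1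
    + 2 * (2 * d + 1) * d + 4) + 12 * (1 + d.+1 + 4 * d.+1 * d.+1) by lia.
  have -> : 12 * (d * d + r) = 12 * d * d + 6 * d - 6 by lia.
  clear -hn cub; nia.
have hT := @star_turan_odd n d ed ltac:(nia).
have [m def_n] : exists m, n = 2 * d.+1 + m by exists (n - 2 * d.+1); nia.
have e1 : n - 2 * d.+1 = m by lia.
rewrite /CH12 /eps (negPf ed); move: hT; rewrite e1.
have -> : 12 * d * d + 12 * d = 12 * (d * d.+1) by lia.
move: (star_turan _ _) => f hT.
have -> : 12 * (d * d.+1) * n = 12 * (d * d.+1 * m) + 12 * (d * d.+1) * (2 * d.+1)
  by rewrite def_n; nia.
move: (d * d.+1 * m) hT => P hT h.
have {h hT} : 12 * n + 24 <= 12 * (d * d.+1) * (2 * d.+1)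
    + 12 * (6 * d.+1 * d.+1 + 2 * (2 * d + 1) * d + 4) + 12 * (1 + d.+1 + 4 * d.+1 * d.+1) by lia.
by clear -hn cub; nia.
Qed.

Local Open Scope ring_scope.

Theorem theorem5 (k n : nat) (hk : (3 <= k)%N)
  (hn : 5 / 2 * k%:R ^+ 3 + 15 / 2 * k%:R ^+ 2 + 26 * k%:R - 3 < n%:R :> rat) :
  ar3 n (star k.+1) = (star_turan n k + 2)%N.
Proof.
have {}hn := size_bound hn; case: k hk hn => // d hk hn.
rewrite /ar3; case: ex_minnP => t forces_t min_t; apply/eqP; rewrite eqn_leq.
apply/andP; split; first by apply: min_t; apply: forced_colors.
apply: ar_forces_gt forces_t => //; nia.
Qed.
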